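(* Let $H$ be a Hopf algebra over a field $k$ with bijective antipode $S$, let $\sigma$ be a normalized and convolution invertible lazy 2-cocycle on $H$, and let $M\in{}_{H(\sigma)}\mathcal{YD}(H)^H$ be finite dimensional. Then: (i) $\mathrm{End}(M)$ becomes an algebra in ${}_H\mathcal{YD}^H$, with $H$-structures $$(h\cdot f)(m)=h_1\cdot f(S_1(h_2)\cdot m),\qquad f_{(0)}(m)\otimes f_{(1)}=f(m_{(0)})_{(0)}\otimes S^{-1}(m_{(1)})f(m_{(0)})_{(1)},$$ for all $h\in H$, $m\in M$, $f\in\mathrm{End}(M)$; (ii) $\mathrm{End}(M)^{op}$ becomes an algebra in ${}_H\mathcal{YD}^H$, with $H$-structures $$(h\cdot f)(m)=h_2\cdot f(S_2(h_1)\cdot m),\qquad f_{(0)}(m)\otimes f_{(1)}=f(m_{(0)})_{(0)}\otimes f(m_{(0)})_{(1)}S(m_{(1)}).$$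
   Context: Sweedler notation $\Delta(h)=h_1\otimes h_2$. A linear map $\sigma:H\otimes H\to k$ is a left 2-cocycle if $\sigma(a_1,b_1)\sigma(a_2b_2,c)=\sigma(b_1,c_1)\sigma(a,b_2c_2)$; normalized if $\sigma(1,h)=\sigma(h,1)=\varepsilon(h)$; lazy if $\sigma(h_1,h'_1)h_2h'_2=\sigma(h_2,h'_2)h_1h'_1$. ''Lazy 2-cocycle'' means lazy left 2-cocycle. $H(\sigma)$ is the algebra on $H$ with unit $1$ and product $h\cdot_\sigma h'=\sigma(h_1,h'_1)h_2h'_2$. The category ${}_{H(\sigma)}\mathcal{YD}(H)^H$ has as objects the $k$-spaces $M$ with a left $H(\sigma)$-action $h\otimes m\mapsto h\cdot m$ and a right $H$-coaction $m\mapsto m_{(0)}\otimes m_{(1)}$ such that $h_1\cdot m_{(0)}\otimes h_2m_{(1)}=(h_2\cdot m)_{(0)}\otimes(h_2\cdot m)_{(1)}h_1$ for all $h\in H$, $m\in M$. For $\sigma$ trivial this is the usual Yetter-Drinfeld category ${}_H\mathcal{YD}^H$. An algebra in ${}_H\mathcal{YD}^H$ is an object of ${}_H\mathcal{YD}^H$ that is an algebra, a left $H$-module algebra and a right $H^{op}$-comodule algebra. The maps $S_1,S_2:H\to H$ are $S_1(h)=\sigma^{-1}(S(h_2),h_3)S(h_1)$ and $S_2(h)=\sigma^{-1}(h_3,S^{-1}(h_2))S^{-1}(h_1)$, with $\sigma^{-1}$ the convolution inverse of $\sigma$. *)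

(* Defs.v *)
From HB Require Import structures.
From mathcomp Require Import all_boot all_algebra.
From mathcomp Require Import boolp.

Set Implicit Arguments.
Unset Strict Implicit.
Unset Printing Implicit Defensive.

Import GRing.Theory.
Local Open Scope ring_scope.
Local Open Scope quotient_scope.

Reserved Notation "V ⊗ W" (at level 39, left associativity).
Reserved Notation "'\sw_' ( a , b <- x ) E"
  (at level 41, E at level 41, a name, b name, x at level 50,
   format "'[' '\sw_' ( a ,  b  <-  x ) '/  '  E ']'").

Section TensorProduct.
Variables (k : fieldType) (V W : lmodType k).
Implicit Types (s t : seq (V * W)).

(* A sequence of pairs stands for the formal sum of its members; the formal
   sums are taken modulo the congruence generated by bilinearity. *)
Inductive tens_rel : seq (V * W) -> seq (V * W) -> Prop :=
| tens_refl s : tens_rel s s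
| tens_sym s t : tens_rel s t -> tens_rel t s
| tens_trans s t u : tens_rel s t -> tens_rel t u -> tens_rel s u
| tens_cat s s' t t' :
    tens_rel s s' -> tens_rel t t' -> tens_rel (s ++ t) (s' ++ t')
| tens_catC s t : tens_rel (s ++ t) (t ++ s)
| tens_zero w : tens_rel [:: (0, w)] [::]
| tens_addl v v' w : tens_rel [:: (v + v', w)] [:: (v, w); (v', w)]
| tens_addr v w w' : tens_rel [:: (v, w + w')] [:: (v, w); (v, w')]
| tens_scale a v w : tens_rel [:: (a *: v, w)] [:: (v, a *: w)].

Definition tens_relb s t : bool := `[< tens_rel s t >].

Fact tens_relb_equiv : equiv_class_of tens_relb.
Proof.
split=> [s|s t|t s u].
- exact/asboolP/tens_refl.
- by apply/asboolP/asboolP; apply: tens_sym.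
- by move=> /asboolP st /asboolP tu; apply/asboolP/(tens_trans st tu).
Qed.

Canonical tens_equiv := EquivRelPack tens_relb_equiv.

Definition tensor := {eq_quot tens_equiv}.
HB.instance Definition _ := EqQuotient.copy tensor {eq_quot tens_equiv}.
HB.instance Definition _ := Choice.copy tensor {eq_quot tens_equiv}.

Implicit Types x y z : tensor.

Lemma tens_piP s t : \pi_tensor s = \pi_tensor t <-> tens_rel s t.
Proof.
split=> [/eqP|st]; first by rewrite eqmodE => /asboolP.
by apply/eqP; rewrite eqmodE; apply/asboolP.
Qed.

Lemma tensW (P : tensor -> Prop) : (forall s, P (\pi_tensor s)) -> forall x, P x.
Proof. by move=> Ps x; rewrite -[x]reprK; apply: Ps. Qed.

Lemma tens_repr s : tens_rel (repr (\pi_tensor s)) s.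
Proof. by apply/tens_piP; rewrite reprK. Qed.

Definition scale_seq (a : k) s := [seq (a *: p.1, p.2) | p <- s].

Lemma scale_seq_cat a s t : scale_seq a (s ++ t) = scale_seq a s ++ scale_seq a t.
Proof. exact: map_cat. Qed.

Lemma scale_seq_rel a s t : tens_rel s t -> tens_rel (scale_seq a s) (scale_seq a t).
Proof.
elim=> {s t} [s|s t _|s t u _ IH _|s s' t t' _ IH _ IH'|s t|w|v v' w|v w w'|b v w] /=.
- exact: tens_refl.
- exact: tens_sym.
- exact: tens_trans.
- by rewrite !scale_seq_cat; apply: tens_cat.
- by rewrite !scale_seq_cat; apply: tens_catC.
- by rewrite scaler0; apply: tens_zero.
- by rewrite scalerDr; apply: tens_addl.
- exact: tens_addr.
- by rewrite scalerA mulrC -scalerA; apply: tens_scale.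
Qed.

Definition tens_add x y : tensor := \pi_tensor (repr x ++ repr y).
Definition tens_mul a x : tensor := \pi_tensor (scale_seq a (repr x)).
Definition tens_opp x := tens_mul (-1) x.
Definition tens0 : tensor := \pi_tensor [::].

Lemma tens_add_pi s t : tens_add (\pi_tensor s) (\pi_tensor t) = \pi_tensor (s ++ t).
Proof. by apply/tens_piP; apply: tens_cat; apply: tens_repr. Qed.

Lemma tens_mul_pi a s : tens_mul a (\pi_tensor s) = \pi_tensor (scale_seq a s).
Proof. exact/tens_piP/scale_seq_rel/tens_repr. Qed.

Lemma tens_addA : associative tens_add.
Proof.
by elim/tensW=> s; elim/tensW=> t; elim/tensW=> u; rewrite !tens_add_pi catA.
Qed.

Lemma tens_addC : commutative tens_add.
Proof.
by elim/tensW=> s; elim/tensW=> t; rewrite !tens_add_pi; apply/tens_piP/tens_catC.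
Qed.

Lemma tens_add0 : left_id tens0 tens_add.
Proof. by elim/tensW=> s; rewrite tens_add_pi. Qed.

Lemma tens_pi_cons p s :
  \pi_tensor (p :: s) = tens_add (\pi_tensor [:: p]) (\pi_tensor s).
Proof. by rewrite tens_add_pi. Qed.

Lemma tens_pi_addl v v' w : \pi_tensor [:: (v + v', w)]
  = tens_add (\pi_tensor [:: (v, w)]) (\pi_tensor [:: (v', w)]).
Proof. by rewrite tens_add_pi; apply/tens_piP/tens_addl. Qed.

Lemma tens_mulDl x : {morph tens_mul^~ x : a b / a + b >-> tens_add a b}.
Proof.
move=> a b; elim/tensW: x => s; rewrite !tens_mul_pi tens_add_pi.
elim: s => [|[v w] s IH]; first by apply/tens_piP/tens_refl.
rewrite /= tens_pi_cons IH scalerDl tens_pi_addl -cat_cons -!tens_add_pi.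
rewrite (tens_pi_cons (a *: v, w) (scale_seq a s)).
rewrite (tens_pi_cons (b *: v, w) (scale_seq b s)).
rewrite -!tens_addA; congr tens_add.
by rewrite !tens_addA; congr tens_add; rewrite tens_addC.
Qed.

Lemma tens_mul0 x : tens_mul 0 x = tens0.
Proof.
elim/tensW: x => s; rewrite tens_mul_pi; apply/tens_piP.
elim: s => [|[v w] s IH]; first exact: tens_refl.
rewrite /= scale0r -cat1s -[X in tens_rel _ X]cats0.
by apply: tens_cat => //; exact: tens_zero.
Qed.

Lemma tens_mul1 x : tens_mul 1 x = x.
Proof.
elim/tensW: x => s; rewrite tens_mul_pi; congr (\pi_tensor _).
by rewrite /scale_seq -[RHS]map_id; apply: eq_map => -[v w] /=; rewrite scale1r.
Qed.

Lemma tens_addN : left_inverse tens0 tens_opp tens_add.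
Proof.
by move=> x; rewrite /tens_opp -{2}[x]tens_mul1 -tens_mulDl addNr tens_mul0.
Qed.

HB.instance Definition _ :=
  GRing.isZmodule.Build tensor tens_addA tens_addC tens_add0 tens_addN.

Lemma tens_mulA a b x : tens_mul a (tens_mul b x) = tens_mul (a * b) x.
Proof.
elim/tensW: x => s; rewrite !tens_mul_pi; congr (\pi_tensor _).
by rewrite /scale_seq -map_comp; apply: eq_map => p /=; rewrite scalerA.
Qed.

Lemma tens_mulDr : right_distributive tens_mul +%R.
Proof.
move=> a; elim/tensW=> s; elim/tensW=> t.
by rewrite [_ + _]tens_add_pi !tens_mul_pi [RHS]tens_add_pi scale_seq_cat.
Qed.

HB.instance Definition _ :=
  GRing.Zmodule_isLmodule.Build k tensor tens_mulA tens_mul1 tens_mulDr tens_mulDl.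

Definition pure (v : V) (w : W) : tensor := \pi_tensor [:: (v, w)].

Lemma pure_linearl w : linear (pure^~ w).
Proof.
move=> a v v'; rewrite [X in _ = X + _]tens_mul_pi [RHS]tens_add_pi.
exact/tens_piP/tens_addl.
Qed.

Lemma pure_linearr v : linear (pure v).
Proof.
move=> a w w'; rewrite [X in _ = X + _]tens_mul_pi [RHS]tens_add_pi.
apply/tens_piP/(tens_trans (tens_addr _ _ _)).
rewrite -cat1s -[X in tens_rel _ X]cat1s.
by apply: tens_cat (tens_refl _); exact/tens_sym/tens_scale.
Qed.

(* Sweedler sums: for F bilinear this is the value at x of the linear map
   induced by F (see [sweedler_linear], [sweedler_pure], [tensor_univ]), so it
   does not depend on the representative of x. *)
Definition sweedler (U : nmodType) x (F : V -> W -> U) : U :=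
  \sum_(p <- repr x) F p.1 p.2.

Section Universal.
Variables (U : lmodType k) (F : V -> W -> U).
Hypothesis Fl : forall w, linear (F^~ w).
Hypothesis Fr : forall v, linear (F v).

Lemma sum_tens_rel s t : tens_rel s t ->
  \sum_(p <- s) F p.1 p.2 = \sum_(p <- t) F p.1 p.2.
Proof.
have FlD v v' w : F (v + v') w = F v w + F v' w.
  by have := Fl w 1 v v'; rewrite !scale1r.
have FrD v w w' : F v (w + w') = F v w + F v w'.
  by have := Fr v 1 w w'; rewrite !scale1r.
have F0l w : F 0 w = 0 by apply: (addrI (F 0 w)); rewrite -FlD !addr0.
have F0r v : F v 0 = 0 by apply: (addrI (F v 0)); rewrite -FrD !addr0.
elim=> {s t} [s|s t _|s t u _ -> _ ->|s s' t t' _ IH _ IH'|s t|w|v v' w|v w w'|b v w] //=.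
- by rewrite !big_cat /= IH IH'.
- by rewrite !big_cat /= addrC.
- by rewrite big_seq1 big_nil /= F0l.
- by rewrite !big_cons big_nil /= !addr0 FlD.
- by rewrite !big_cons big_nil /= !addr0 FrD.
- rewrite !big_seq1 /=; have := Fl w b v 0; have := Fr v b w 0.
  by rewrite !addr0 F0l F0r !addr0 => -> ->.
Qed.

Lemma sweedler_pi s : sweedler (\pi_tensor s) F = \sum_(p <- s) F p.1 p.2.
Proof. exact/sum_tens_rel/tens_repr. Qed.

Lemma sweedler_pure v w : sweedler (pure v w) F = F v w.
Proof. by rewrite sweedler_pi big_seq1. Qed.

Lemma sweedler_linear : linear (fun x : tensor => sweedler x F).
Proof.
move=> a; elim/tensW=> s; elim/tensW=> t.
rewrite [X in X + _]tens_mul_pi [X in sweedler X _]tens_add_pi !sweedler_pi big_cat /=.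
rewrite big_map scaler_sumr; congr (_ + _); apply: eq_bigr => p _ /=.
have := Fl p.2 a p.1 0; rewrite addr0 => ->.
have := Fl p.2 1 0 0; rewrite scaler0 addr0 scale1r => /(congr1 (+%R^~ (- F 0 p.2))).
by rewrite addrK subrr => <-; rewrite addr0.
Qed.

End Universal.

Lemma sweedler_id x : sweedler x pure = x.
Proof.
rewrite -[RHS]reprK /sweedler; elim: (repr x) => [|[v w] s IH].
  by rewrite big_nil.
by rewrite big_cons IH -cat1s [LHS]tens_add_pi.
Qed.

Lemma tensor_univ (U : lmodType k) (F : V -> W -> U) :
    (forall w, linear (F^~ w)) -> (forall v, linear (F v)) ->
  exists2 L : {linear tensor -> U}, forall v w, L (pure v w) = F v w
    & forall L' : {linear tensor -> U},
        (forall v w, L' (pure v w) = F v w) -> L' =1 L.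
Proof.
move=> Fl Fr.
pose L0 x := sweedler x F.
pose Lm := GRing.isLinear.Build k tensor U *:%R L0 (sweedler_linear Fl Fr).
pose L : {linear tensor -> U} := HB.pack L0 Lm.
exists L => [v w|L' L'E x]; first exact: sweedler_pure.
rewrite -{1}[x]sweedler_id /sweedler raddf_sum /=.
by apply: eq_bigr => p _; rewrite L'E.
Qed.

End TensorProduct.

Arguments pure {k V W} v w.

Notation "V ⊗ W" := (tensor V W) : type_scope.
Notation "v ⊗ w" := (pure v w) : ring_scope.
Notation "\sw_ ( a , b <- x ) E" := (sweedler x (fun a b => E)) : ring_scope.

Section Evaluation.
Variables (k : fieldType) (M : vectType k) (H : lmodType k).

Fact linear_sum_of (U U' : lmodType k) (f : U -> U') (f_lin : linear f) I r
    (F : I -> U) : f (\sum_(i <- r) F i) = \sum_(i <- r) f (F i).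
Proof.
pose fM := GRing.isLinear.Build k U U' *:%R f f_lin.
pose g : {linear U -> U'} := HB.pack f fM.
exact: (raddf_sum g).
Qed.

(* Since M is finite dimensional, an element of End(M) ⊗ H is determined by
   its values in M ⊗ H. *)
Lemma tensor_end_inj (x y : ('End(M) ⊗ H)%type) :
  (forall m, \sw_(f, h <- x) (f m ⊗ h) = \sw_(f, h <- y) (f m ⊗ h)) -> x = y.
Proof.
pose e := vbasis (fullv : {vspace M}).
pose L0 i (n : M) m := coord e i m *: n.
have L0_lin i n : linear (L0 i n).
  by move=> a u v; rewrite /L0 linearP scalerDl scalerA.
pose L i n : 'End(M) := linfun (HB.pack (L0 i n)
  (GRing.isLinear.Build k M M *:%R (L0 i n) (L0_lin i n)) : {linear M -> M}).
have LE i n m : L i n m = coord e i m *: n by rewrite lfunE.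
have L_lin i : linear (L i).
  move=> a u v; apply/lfunP=> m; rewrite add_lfunE scale_lfunE !LE.
  by rewrite scalerDr !scalerA mulrC.
pose G i n h : ('End(M) ⊗ H)%type := L i n ⊗ h.
have Gl i h : linear (G i^~ h).
  by move=> a u v; rewrite /G L_lin; apply: pure_linearl.
have Gr i n : linear (G i n) by exact: pure_linearr.
suff recover (z : ('End(M) ⊗ H)%type) :
    z = \sum_(i < \dim {:M}) sweedler (\sw_(f, h <- z) (f e`_i ⊗ h)) (G i).
  by move=> xy; rewrite (recover x) (recover y); under eq_bigr do rewrite xy.
rewrite -{1}(sweedler_id z) {1}/sweedler.
under [RHS]eq_bigr => i _.
  rewrite (linear_sum_of (sweedler_linear (Gl i) (Gr i))).
  under eq_bigr => p _ do rewrite (sweedler_pure (Gl i) (Gr i)).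
  over.
rewrite exchange_big; apply: eq_bigr => -[f h] _ /=.
rewrite -(linear_sum_of (pure_linearl h)); congr (_ ⊗ _).
apply/lfunP=> m; rewrite sum_lfunE {1}(coord_vbasis (memvf m)) linear_sum.
by apply: eq_bigr => i _; rewrite LE linearZ.
Qed.

End Evaluation.

Record hopfAlgebra (k : fieldType) := HopfAlgebra {
  hopf_alg :> algType k;
  comul : {linear hopf_alg -> (hopf_alg ⊗ hopf_alg)%type};
  counit : {scalar hopf_alg};
  antipode : {linear hopf_alg -> hopf_alg};
  comulA : forall h,
    \sw_(a, b <- comul h) \sw_(a1, a2 <- comul a) (a1 ⊗ a2 ⊗ b)
    = \sw_(a, b <- comul h) \sw_(b1, b2 <- comul b) (a ⊗ b1 ⊗ b2);
  counitl : forall h, \sw_(a, b <- comul h) (counit a *: b) = h;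
  counitr : forall h, \sw_(a, b <- comul h) (counit b *: a) = h;
  comulM : forall g h, comul (g * h)
    = \sw_(g1, g2 <- comul g) \sw_(h1, h2 <- comul h) ((g1 * h1) ⊗ (g2 * h2));
  comul1 : comul 1 = 1 ⊗ 1;
  counitM : forall g h, counit (g * h) = counit g * counit h;
  counit1 : counit 1 = 1;
  antipodel : forall h, \sw_(a, b <- comul h) (antipode a * b) = counit h *: 1;
  antipoder : forall h, \sw_(a, b <- comul h) (a * antipode b) = counit h *: 1
}.

Arguments comul {k h0} : rename.
Arguments counit {k h0} : rename.
Arguments antipode {k h0} : rename.

Section Cocycles.
Variables (k : fieldType) (H : hopfAlgebra k).
Implicit Types (sigma tau : {scalar (H ⊗ H)%type}) (a b c g h : H).

Definition left_2cocycle sigma := forall a b c,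
  \sw_(a1, a2 <- comul a) \sw_(b1, b2 <- comul b)
    (sigma (a1 ⊗ b1) * sigma ((a2 * b2) ⊗ c))
  = \sw_(b1, b2 <- comul b) \sw_(c1, c2 <- comul c)
    (sigma (b1 ⊗ c1) * sigma (a ⊗ (b2 * c2))).

Definition normalized sigma := forall h,
  sigma (1 ⊗ h) = counit h /\ sigma (h ⊗ 1) = counit h.

Definition lazy sigma := forall g h,
  \sw_(g1, g2 <- comul g) \sw_(h1, h2 <- comul h) (sigma (g1 ⊗ h1) *: (g2 * h2))
  = \sw_(g1, g2 <- comul g) \sw_(h1, h2 <- comul h) (sigma (g2 ⊗ h2) *: (g1 * h1)).

Definition convolution_inverse sigma tau := forall g h,
  \sw_(g1, g2 <- comul g) \sw_(h1, h2 <- comul h) (sigma (g1 ⊗ h1) * tau (g2 ⊗ h2))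
    = counit g * counit h
  /\
  \sw_(g1, g2 <- comul g) \sw_(h1, h2 <- comul h) (tau (g1 ⊗ h1) * sigma (g2 ⊗ h2))
    = counit g * counit h.

Definition cocycle_mul sigma g h : H :=
  \sw_(g1, g2 <- comul g) \sw_(h1, h2 <- comul h) (sigma (g1 ⊗ h1) *: (g2 * h2)).

Lemma cocycle_mul_trivial sigma :
  (forall a b, sigma (a ⊗ b) = counit a * counit b) ->
  forall g h, cocycle_mul sigma g h = g * h.
Proof.
move=> sigmaE g h; rewrite -[in RHS](counitl g) -[in RHS](counitl h).
rewrite /cocycle_mul /sweedler mulr_suml; apply: eq_bigr => p _.
rewrite mulr_sumr; apply: eq_bigr => q _.
by rewrite sigmaE -scalerAl -scalerAr scalerA.
Qed.

(* In S1 and S2, [tau] is the convolution inverse of the cocycle and [Sinv]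
   the inverse of the antipode. *)
Definition S1 tau h : H :=
  \sw_(h1, h' <- comul h) \sw_(h2, h3 <- comul h')
    (tau (antipode h2 ⊗ h3) *: antipode h1).

Definition S2 tau (Sinv : H -> H) h : H :=
  \sw_(h1, h' <- comul h) \sw_(h2, h3 <- comul h')
    (tau (h3 ⊗ Sinv h2) *: Sinv h1).

End Cocycles.

Section YetterDrinfeld.
Variables (k : fieldType) (H : hopfAlgebra k).

(* Left modules over the k-space H with multiplication [mul] and unit 1. *)
Definition is_left_module (mul : H -> H -> H) (M : lmodType k)
    (act : {linear (H ⊗ M)%type -> M}) :=
  (forall m, act (1 ⊗ m) = m) /\
  (forall g h m, act (mul g h ⊗ m) = act (g ⊗ act (h ⊗ m))).

Definition is_right_comodule (M : lmodType k)
    (rho : {linear M -> (M ⊗ H)%type}) :=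
  (forall m, \sw_(m0, m1 <- rho m) (counit m1 *: m0) = m) /\
  (forall m, \sw_(m0, m1 <- rho m) \sw_(m00, m01 <- rho m0) (m00 ⊗ m01 ⊗ m1)
    = \sw_(m0, m1 <- rho m) \sw_(h1, h2 <- comul m1) (m0 ⊗ h1 ⊗ h2)).

(* Only the action refers to [mul]: the products in the tensor factor H of
   M ⊗ H are those of the Hopf algebra H. *)
Definition YD_compatible (M : lmodType k)
    (act : {linear (H ⊗ M)%type -> M}) (rho : {linear M -> (M ⊗ H)%type}) :=
  forall h m,
    \sw_(h1, h2 <- comul h) \sw_(m0, m1 <- rho m) (act (h1 ⊗ m0) ⊗ (h2 * m1))
    = \sw_(h1, h2 <- comul h) \sw_(n0, n1 <- rho (act (h2 ⊗ m))) (n0 ⊗ (n1 * h1)).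

Definition is_YD_over (mul : H -> H -> H) (M : lmodType k)
    (act : {linear (H ⊗ M)%type -> M}) (rho : {linear M -> (M ⊗ H)%type}) :=
  [/\ is_left_module mul act, is_right_comodule rho & YD_compatible act rho].

Definition is_YD (M : lmodType k) :=
  @is_YD_over (fun g h => g * h) M.

Definition is_twisted_YD (sigma : {scalar (H ⊗ H)%type}) (M : lmodType k) :=
  @is_YD_over (cocycle_mul sigma) M.

(* The multiplication is explicit because the library's algebras are nonzero,
   whereas End(M) is zero for M = 0. *)
Definition is_algebra (A : lmodType k) (mul : A -> A -> A) (one : A) :=
  [/\ (forall b, linear (mul^~ b)) /\ (forall a, linear (mul a)),
      associative mul, left_id one mul & right_id one mul].

Definition is_module_algebra (A : lmodType k) (mul : A -> A -> A) (one : A)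
    (act : {linear (H ⊗ A)%type -> A}) :=
  (forall h a b, act (h ⊗ mul a b)
    = \sw_(h1, h2 <- comul h) mul (act (h1 ⊗ a)) (act (h2 ⊗ b))) /\
  (forall h, act (h ⊗ one) = counit h *: one).

Definition is_op_comodule_algebra (A : lmodType k) (mul : A -> A -> A) (one : A)
    (rho : {linear A -> (A ⊗ H)%type}) :=
  (forall a b, rho (mul a b)
    = \sw_(a0, a1 <- rho a) \sw_(b0, b1 <- rho b) (mul a0 b0 ⊗ (b1 * a1))) /\
  rho one = one ⊗ 1.

Definition is_YD_algebra (A : lmodType k) (mul : A -> A -> A) (one : A)
    (act : {linear (H ⊗ A)%type -> A}) (rho : {linear A -> (A ⊗ H)%type}) :=
  [/\ is_YD act rho, is_algebra mul one, is_module_algebra mul one act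
    & is_op_comodule_algebra mul one rho].

End YetterDrinfeld.

(* Main.v *)
Require Import Defs.
From HB Require Import structures.
From mathcomp Require Import all_boot all_algebra.

(** Write L(h) for the action of h on M.  The antipode-like maps S1 and S2 are
    made so that h |-> L(S1(h)) is the convolution inverse Lbar of L, and
    h |-> L(S2(h)) its convolution inverse for the opposite coproduct.  Hence
    the two H-structures are the adjoint actions L(h_1) f Lbar(h_2) and
    L(h_2) f Lbar(h_1), which explains why they are module algebra structures;
    the only surprising point is that they are actions of H and not of the
    twisted algebra H(sigma), and this is where laziness enters.

    Nearly every identity follows from division by L on the right
    ([conv_divr]): an F with F(h_1) L(h_2) = phi(h) is phi(h_1) Lbar(h_2).

    - The inverse ([act_S1_left], [act_S1_right]).  Write . for the twisted
      product.  Undoing the twist of S(h_1) . h_2 by tau gives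
      S1(h_1) . h_2 = epsilon(h), and undoing that of h_1 . S(h_2), after moving
      sigma to the other side by laziness, gives a right inverse of another
      shape.  A left and a right inverse agree.

    - The action ([adjM]).  The endomorphism h.f is characterised by
      (h_1.f) L(h_2) = L(h) f.  To get (gh).f = g.(h.f), divide twice, by L(h)
      and by L(g); it remains to compute ((g_1 h_1).f) L(g_2) L(h_2).  Here
      L(g_2) L(h_2) is sigma(g_3, h_3) L(g_2 h_2) by laziness, so the sum
      collapses to sigma(g_2, h_2) L(g_1 h_1) f = L(g) L(h) f.

    - The coaction ([end_rho_comodule], [end_rho_comp]).  An element of
      End(M) (x) H is a linear map M -> M (x) H because M is finite dimensional.
      Both coactions have the form f(m_0)_0 (x) mu(m_1, f(m_0)_1), with
      mu(x, y) = S^-1(x) y or y S(x), and the comodule axioms use only a few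
      properties that these two operations share.

    - Compatibility ([end_YD_left], [end_YD_right]).  Dividing the compatibility
      of M by L shows how the coaction of M moves past Lbar:
      (Lbar(h_1)m)_0 (x) h_2 T((Lbar(h_1)m)_1) is the same as
      Lbar(h_2)m_0 (x) T(m_1) h_1 for T = S^-1 in the first case and T = S in the
      second ([sw_inverse_coaction]).  With this the compatibility for End(M)
      becomes that of M.

    The second action is the first one for the Hopf algebra H with opposite
    coproduct and antipode S^-1 ([coopposite]), so its module algebra axioms need
    no separate proof. *)

Set Implicit Arguments.
Unset Strict Implicit.
Unset Printing Implicit Defensive.

Import GRing.Theory.
Local Open Scope ring_scope.

(** * Multilinear maps and Sweedler sums *)

Section Linear.
Variable k : fieldType.
Implicit Types U V W X : lmodType k.

Definition bilin U V W (F : U -> V -> W) :=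
  (forall v, linear (F^~ v)) /\ (forall u, linear (F u)).

Definition trilin U V W X (F : U -> V -> W -> X) :=
  [/\ forall v w, linear (fun u => F u v w),
      forall u w, linear (fun v => F u v w)
    & forall u v, linear (F u v)].

Lemma lin_id U : linear (fun x : U => x).
Proof. by []. Qed.

Lemma lin_app U V W (f : {linear V -> W}) (g : U -> V) :
  linear g -> linear (fun x => f (g x)).
Proof. by move=> gl a u v; rewrite gl linearP. Qed.

Lemma lin_lfun U (V : vectType k) (W : vectType k) (f : 'Hom(V, W)) (g : U -> V) :
  linear g -> linear (fun x => f (g x)).
Proof. by move=> gl a u v; rewrite gl linearP. Qed.

Lemma lin_eval U (V : vectType k) (W : vectType k) (g : U -> 'Hom(V, W)) v :
  linear g -> linear (fun x => g x v).
Proof. by move=> gl a u w; rewrite gl add_lfunE scale_lfunE. Qed.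

Lemma lin_scale U V a (g : U -> V) : linear g -> linear (fun x => a *: g x).
Proof. by move=> gl b u v; rewrite gl scalerDr !scalerA mulrC. Qed.

Lemma lin_scal U V W (s : {scalar V}) (g : U -> V) (w : W) :
  linear g -> linear (fun x => s (g x) *: w).
Proof. by move=> gl b u v; rewrite gl linearP /= scalerDl scalerA. Qed.

Lemma lin_bill U V W X (F : V -> W -> X) (g : U -> V) w :
  bilin F -> linear g -> linear (fun x => F (g x) w).
Proof. by move=> [Fl _] gl b u v; rewrite gl Fl. Qed.

Lemma lin_bilr U V W X (F : V -> W -> X) (g : U -> W) v :
  bilin F -> linear g -> linear (fun x => F v (g x)).
Proof. by move=> [_ Fr] gl b u w; rewrite gl Fr. Qed.

Lemma bilin_pure U V : bilin (@pure k U V).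
Proof. by split=> ?; [apply: pure_linearl | apply: pure_linearr]. Qed.

Lemma lin_purel U V W (g : U -> V) (w : W) :
  linear g -> linear (fun x => g x ⊗ w).
Proof. exact: lin_bill (bilin_pure V W). Qed.

Lemma lin_purer U V W (g : U -> W) (v : V) :
  linear g -> linear (fun x => v ⊗ g x).
Proof. exact: lin_bilr (bilin_pure V W). Qed.

Lemma lin_mull (A : algType k) U (g : U -> A) b :
  linear g -> linear (fun x => g x * b).
Proof. by move=> gl a u v; rewrite gl mulrDl -scalerAl. Qed.

Lemma lin_mulr (A : algType k) U (g : U -> A) b :
  linear g -> linear (fun x => b * g x).
Proof. by move=> gl a u v; rewrite gl mulrDr -scalerAr. Qed.

Lemma lin_swr U V W X (t : (V ⊗ W)%type) (F : U -> V -> W -> X) :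
  (forall v w, linear (fun x => F x v w)) ->
  linear (fun x => sweedler t (F x)).
Proof.
move=> Fl a u v; rewrite /sweedler scaler_sumr -big_split /=.
by apply: eq_bigr => p _; rewrite Fl.
Qed.

Lemma lin_swl U V W X (t : U -> (V ⊗ W)%type) (F : V -> W -> X) :
  linear t -> bilin F -> linear (fun x => sweedler (t x) F).
Proof. by move=> tl [Fl Fr] a u v; rewrite tl sweedler_linear. Qed.


End Linear.

Arguments lin_app {k U V W f g} _.
Arguments lin_lfun {k U V W f g} _.
Arguments lin_eval {k U V W g v} _.
Arguments lin_scale {k U V a g} _.
Arguments lin_scal {k U V W s g w} _.
Arguments lin_purel {k U V W g w} _.
Arguments lin_purer {k U V W g v} _.
Arguments lin_mull {k A U g b} _.
Arguments lin_mulr {k A U g b} _.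
Arguments lin_swr {k U V W X t F} _.
Arguments lin_swl {k U V W X t F} _ _.
Arguments lin_bill {k U V W X F g w} _ _.
Arguments lin_bilr {k U V W X F g v} _ _.

Lemma lin_homog (k : fieldType) (U V : lmodType k) (f : U -> V) :
  linear f -> forall a u, f (a *: u) = a *: f u.
Proof.
move=> fl a u; have f0 : f 0 = 0.
  by have := fl (-1) 0 0; rewrite scaler0 addr0 scaleN1r addNr.
by have := fl a u 0; rewrite f0 !addr0.
Qed.

(** Linearity side conditions accompany every manipulation of a Sweedler sum,
    which is only meaningful for multilinear summands.  This tactic settles them
    by following the structure of the term; bilinear operations in the context
    are used as they are met. *)
Ltac lin1 := cbv beta;
  lazymatch goal with
  | |- bilin _ => first [assumption | split]
  | |- trilin _ => first [assumption | split]
  | |- @GRing.linear_for _ _ _ _ _ =>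
    first
    [ assumption
    | refine (@lin_id _ _)
    | refine (lin_purel _) | refine (lin_purer _)
    | refine (lin_scale _)
    | refine (lin_scal _)
    | refine (lin_mull _) | refine (lin_mulr _)
    | refine (lin_swr _) | refine (lin_swl _ _)
    | refine (lin_app _) | refine (lin_lfun _) | refine (lin_eval _)
    | match goal with Fb : bilin ?F |- _ =>
        first [ exact (proj1 Fb _) | exact (proj2 Fb _)
              | refine (lin_bill Fb _) | refine (lin_bilr Fb _) ] end
    | match goal with Fb : context[@GRing.linear_for] |- _ => solve [apply Fb] end ]
  | |- forall _, _ => intro
  end.
Ltac lin := repeat lin1.

Section Sweedler.
Variable k : fieldType.
Implicit Types U V W X Y : lmodType k.

Lemma eq_sw U V (W : nmodType) (t : (U ⊗ V)%type) (F G : U -> V -> W) :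
  (forall a b, F a b = G a b) -> sweedler t F = sweedler t G.
Proof. by move=> FG; apply: eq_bigr => p _. Qed.

Lemma sw_lin V W X Y (f : X -> Y) (t : (V ⊗ W)%type) F :
  linear f -> f (sweedler t F) = \sw_(a, b <- t) f (F a b).
Proof. by move=> fl; apply: linear_sum_of. Qed.

Lemma swZ V W X c (t : (V ⊗ W)%type) (F : V -> W -> X) :
  c *: sweedler t F = \sw_(a, b <- t) (c *: F a b).
Proof. exact: scaler_sumr. Qed.

Lemma sw_scal V W X (t : (V ⊗ W)%type) (F : V -> W -> k) (x : X) :
  sweedler t F *: x = \sw_(a, b <- t) (F a b *: x).
Proof. exact: scaler_suml. Qed.

Lemma swC V W V' W' X (t : (V ⊗ W)%type) (t' : (V' ⊗ W')%type)
    (F : V -> W -> V' -> W' -> X) :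
  \sw_(a, b <- t) \sw_(c, d <- t') F a b c d
  = \sw_(c, d <- t') \sw_(a, b <- t) F a b c d.
Proof. exact: exchange_big. Qed.

Lemma sw_pure V W X (F : V -> W -> X) v w :
  bilin F -> \sw_(a, b <- v ⊗ w) F a b = F v w.
Proof. by move=> [Fl Fr]; apply: sweedler_pure. Qed.

Lemma sw_sw V W V' W' X (t : (V ⊗ W)%type) (G : V -> W -> (V' ⊗ W')%type)
    (F : V' -> W' -> X) : bilin F ->
  \sw_(c, d <- \sw_(a, b <- t) G a b) F c d
  = \sw_(a, b <- t) \sw_(c, d <- G a b) F c d.
Proof. by move=> [Fl Fr]; exact: (sw_lin _ _ (sweedler_linear Fl Fr)). Qed.

Lemma sw3 U V W X (F : U -> V -> W -> X) : trilin F ->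
  bilin (fun t w => \sw_(u, v <- t) F u v w).
Proof. by move=> [Fu Fv Fw]; lin. Qed.

End Sweedler.

(** * Convolution and the antipode *)

Section Coassoc.
Variables (k : fieldType) (H : hopfAlgebra k).
Implicit Types (U W : lmodType k) (g h : H).

(** Coassociativity as it is used in calculations: the tensor identity is mapped
    through the linear map that a trilinear F induces on the triple tensor
    power. *)
Lemma swA U h (F : H -> H -> H -> U) : trilin F ->
  \sw_(a, b <- comul h) \sw_(a1, a2 <- comul a) F a1 a2 b
  = \sw_(a, b <- comul h) \sw_(b1, b2 <- comul b) F a b1 b2.
Proof.
move=> Ft; have Fb := sw3 Ft; case: (Ft) => F1 F2 F3.
pose phi t := \sw_(u, c <- t) \sw_(a, b <- u) F a b c.
transitivity (phi (\sw_(a, b <- comul h) \sw_(a1, a2 <- comul a) (a1 ⊗ a2 ⊗ b))).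
  rewrite /phi sw_sw //; apply: eq_sw => a b; rewrite sw_sw //; apply: eq_sw => c d.
  by rewrite !sw_pure //; lin.
rewrite comulA /phi sw_sw //; apply: eq_sw => a b; rewrite sw_sw //.
by apply: eq_sw => c d; rewrite !sw_pure //; lin.
Qed.

Lemma sw_counitl U h (F : H -> U) :
  linear F -> \sw_(a, b <- comul h) (counit a *: F b) = F h.
Proof.
move=> Fl; rewrite -[in RHS](counitl h) (sw_lin _ _ Fl).
by apply: eq_sw => a b; rewrite (lin_homog Fl).
Qed.

Lemma sw_counitr U h (F : H -> U) :
  linear F -> \sw_(a, b <- comul h) (counit b *: F a) = F h.
Proof.
move=> Fl; rewrite -[in RHS](counitr h) (sw_lin _ _ Fl).
by apply: eq_sw => a b; rewrite (lin_homog Fl).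
Qed.

Lemma sw_antipodel U h (F : H -> U) : linear F ->
  \sw_(a, b <- comul h) F (antipode a * b) = counit h *: F 1.
Proof. by move=> Fl; rewrite -(sw_lin _ _ Fl) antipodel (lin_homog Fl). Qed.

Lemma sw_antipoder U h (F : H -> U) : linear F ->
  \sw_(a, b <- comul h) F (a * antipode b) = counit h *: F 1.
Proof. by move=> Fl; rewrite -(sw_lin _ _ Fl) antipoder (lin_homog Fl). Qed.

(** Division on the right in the convolution algebra: insert
    L(h_2) Lbar(h_3) = epsilon(h_2) after F(h_1).  The product is composition of
    operators, and F may lead to another space than the one on which L acts,
    which allows F to be a coaction composed with operators. *)
Lemma conv_divr U W (F phi : H -> U -> W) (L Lbar : H -> U -> U) :
    bilin F -> bilin phi -> bilin L -> bilin Lbar ->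
    (forall h u, \sw_(a, b <- comul h) L a (Lbar b u) = counit h *: u) ->
    (forall h u, \sw_(a, b <- comul h) F a (L b u) = phi h u) ->
  forall h u, F h u = \sw_(a, b <- comul h) phi a (Lbar b u).
Proof.
move=> Fb phib Lbil Lbarb LLb FL h u.
transitivity (\sw_(a, b <- comul h) \sw_(c, d <- comul b) F a (L c (Lbar d u))).
  rewrite -(sw_counitr h (proj1 Fb u)); apply: eq_sw => a b.
  by rewrite -(lin_homog (proj2 Fb a)) -LLb (sw_lin _ _ (proj2 Fb a)).
rewrite -swA; last by lin.
by apply: eq_sw => a b; rewrite -FL.
Qed.

(** S(gh) divided by g and then by h: multiplying S(g_1 h_1) on the right by
    g_2 h_2 gives epsilon(g) epsilon(h). *)
Lemma antipodeM g h : antipode (g * h : H) = antipode h * antipode g.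
Proof.
pose phi h g u : H := \sw_(a, b <- comul g) (antipode (a * h) * (b * u)).
have phiE g' h' u : phi h' g' u = counit g' *: (antipode h' * u).
  have -> : phi h' g' u
     = \sw_(a, b <- comul h') (counit g' *: (counit a *: (antipode b * u))).
    apply: (@conv_divr H H (fun h u => phi h g' u)
      (fun h u => counit g' *: (counit h *: u)) *%R
      (fun h u => antipode h * u)) => [||||x v|x v]; try by lin.
      under eq_sw => a b do rewrite mulrA.
      by rewrite (@sw_antipoder _ _ (fun x => x * v)) ?mul1r; lin.
    rewrite /phi swC scalerA -counitM.
    rewrite -[v in RHS]mul1r -(@sw_antipodel _ _ (fun x => x * v)); last by lin.
    rewrite comulM sw_sw; last by lin.
    apply: eq_sw => a b; rewrite sw_sw; last by lin.
    by apply: eq_sw => c d; rewrite sw_pure -?mulrA //; lin.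
  by rewrite -swZ (@sw_counitl _ _ (fun x => antipode x * u)); lin.
rewrite -[LHS]mulr1 (@conv_divr H H (fun g u => antipode (g * h) * u)
   (phi h) *%R (fun g u => antipode g * u)) => [|||||x u|//]; try by rewrite /phi; lin.
  under eq_sw => a b do rewrite phiE mulr1.
  by rewrite (@sw_counitl _ _ (fun x => antipode h * antipode x)); lin.
under eq_sw => a b do rewrite mulrA.
by rewrite (@sw_antipoder _ _ (fun x => x * u)) ?mul1r; lin.
Qed.

Lemma antipode1 : antipode 1 = 1 :> H.
Proof.
have := antipodel (1 : H); rewrite comul1 sw_pure ?mulr1 ?counit1 ?scale1r //.
by lin.
Qed.

Lemma counit_antipode h : counit (antipode h) = counit h.
Proof.
have := congr1 counit (antipoder h); rewrite linearZ /= counit1 mulr1 => <-.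
rewrite -[LHS]mulr1 -[in LHS](counitl h).
rewrite linear_sum linear_sum mulr_suml linear_sum; apply: eq_bigr => p _ /=.
by rewrite counitM !linearZ /= mulr1.
Qed.

(** The product of the algebra H (x) H. *)
Definition tmul (X Y : (H ⊗ H)%type) : (H ⊗ H)%type :=
  \sw_(a, b <- X) \sw_(c, d <- Y) ((a * c) ⊗ (b * d)).

Lemma comul_tmul g h : comul (g * h : H) = tmul (comul g) (comul h).
Proof. exact: comulM. Qed.

Lemma tmul_bilin : bilin tmul.
Proof. by rewrite /tmul; lin. Qed.

Lemma tmulA : associative tmul.
Proof.
move=> X Y Z; rewrite /tmul [RHS]sw_sw; last by lin.
apply: eq_sw => a b; rewrite !sw_sw; try by lin.
apply: eq_sw => c d; rewrite sw_sw ?sw_pure; try by lin.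
apply: eq_sw => e f; rewrite sw_pure ?mulrA; try by lin.
Qed.

Lemma tmul1 : left_id (1 ⊗ 1) tmul.
Proof.
move=> X; rewrite /tmul sw_pure; last by lin.
under eq_sw => a b do rewrite !mul1r.
exact: sweedler_id.
Qed.

Lemma tmul1r : right_id (1 ⊗ 1) tmul.
Proof.
move=> X; rewrite /tmul -[RHS]sweedler_id; apply: eq_sw => a b.
by rewrite sw_pure ?mulr1 //; lin.
Qed.

(** Both sides are convolution inverses of the coproduct, viewed as operators of
    left multiplication on H (x) H. *)
Lemma comul_antipode h :
  comul (antipode h) = \sw_(a, b <- comul h) (antipode b ⊗ antipode a) :> (H ⊗ H)%type.
Proof.
pose Sb (h : H) := \sw_(a, b <- comul h) (antipode b ⊗ antipode a).
have tb := tmul_bilin.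
have Sbl : linear Sb by rewrite /Sb; lin.
rewrite -[LHS]tmul1r (@conv_divr _ _ (fun h X => tmul (comul (antipode h)) X)
  (fun h X => counit h *: X) (fun h => tmul (comul h)) (fun h => tmul (Sb h)))
  => [|||||x X|x X]; try by lin.
- under eq_sw => a b do rewrite tmul1r.
  by rewrite sw_counitl.
- under eq_sw => a b do rewrite tmulA.
  rewrite -(sw_lin _ (fun a b => tmul (comul a) (Sb b)) (proj1 tb X)).
  suff -> : \sw_(a, b <- comul x) tmul (comul a) (Sb b) = counit x *: (1 ⊗ 1).
    by rewrite (lin_homog (proj1 tb X)) tmul1.
  transitivity (\sw_(a, b <- comul x) \sw_(a1, a2 <- comul a) \sw_(c, d <- comul b)
      ((a1 * antipode d) ⊗ (a2 * antipode c))).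
    apply: eq_sw => a b; apply: eq_sw => a1 a2.
    rewrite /Sb sw_sw; last by lin.
    by apply: eq_sw => c d; rewrite sw_pure; lin.
  rewrite swA; last by lin.
  rewrite -(@sw_antipoder _ _ (fun x => x ⊗ 1)); last by lin.
  apply: eq_sw => a b; rewrite -swA; last by lin.
  rewrite -(@sw_counitl _ b (fun d => (a * antipode d) ⊗ 1)); last by lin.
  apply: eq_sw => c d.
  by rewrite (@sw_antipoder _ _ (fun x => (a * antipode d) ⊗ x)); lin.
under eq_sw => a b do rewrite tmulA -comul_tmul.
rewrite -(sw_lin _ (fun a b => comul (antipode a * b)) (proj1 tb X)).
rewrite (@sw_antipodel _ _ comul) ?comul1; last by lin.
by rewrite (lin_homog (proj1 tb X)) tmul1.
Qed.

End Coassoc.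

(** * The coopposite Hopf algebra *)

Section Coopposite.
Variables (k : fieldType) (H : hopfAlgebra k).
Variables (Sinv : H -> H) (SK : cancel antipode Sinv) (SinvK : cancel Sinv antipode).
Implicit Types (U : lmodType k) (g h : H).

Fact Sinv_lin : linear Sinv.
Proof. by move=> a u v; apply: (can_inj SK); rewrite linearP /= !SinvK. Qed.

Definition antipode_inv : {linear H -> H} :=
  HB.pack Sinv (GRing.isLinear.Build k H H *:%R Sinv Sinv_lin).

Definition comul_cop_fun h : (H ⊗ H)%type := \sw_(a, b <- comul h) (b ⊗ a).

Fact comul_cop_lin : linear comul_cop_fun.
Proof. by rewrite /comul_cop_fun; lin. Qed.

Definition comul_cop : {linear H -> (H ⊗ H)%type} :=
  HB.pack comul_cop_fun
    (GRing.isLinear.Build k H (H ⊗ H)%type *:%R comul_cop_fun comul_cop_lin).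

Lemma sw_cop U h (F : H -> H -> U) : bilin F ->
  \sw_(a, b <- comul_cop h) F a b = \sw_(a, b <- comul h) F b a.
Proof.
by move=> Fb; rewrite /= sw_sw //; apply: eq_sw => a b; rewrite sw_pure.
Qed.

Fact cop_comulA h :
  \sw_(a, b <- comul_cop h) \sw_(a1, a2 <- comul_cop a) (a1 ⊗ a2 ⊗ b)
  = \sw_(a, b <- comul_cop h) \sw_(b1, b2 <- comul_cop b) (a ⊗ b1 ⊗ b2).
Proof.
rewrite !sw_cop; try by lin.
under eq_sw => a b do [rewrite sw_cop; last by lin].
rewrite -(@swA _ _ _ _ (fun a b c => c ⊗ b ⊗ a)); last by lin.
by apply: eq_sw => a b; rewrite sw_cop //; lin.
Qed.

Fact cop_counitl h : \sw_(a, b <- comul_cop h) (counit a *: b) = h.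
Proof. by rewrite sw_cop ?counitr //; lin. Qed.

Fact cop_counitr h : \sw_(a, b <- comul_cop h) (counit b *: a) = h.
Proof. by rewrite sw_cop ?counitl //; lin. Qed.

Fact cop_comulM g h : comul_cop (g * h)
  = \sw_(g1, g2 <- comul_cop g) \sw_(h1, h2 <- comul_cop h) ((g1 * h1) ⊗ (g2 * h2)).
Proof.
rewrite sw_cop; last by lin.
rewrite /= /comul_cop_fun comulM sw_sw; last by lin.
apply: eq_sw => a b; rewrite !sw_sw; try by lin.
by apply: eq_sw => c d; rewrite !sw_pure //; lin.
Qed.

Fact cop_comul1 : comul_cop 1 = 1 ⊗ 1.
Proof. by rewrite /= /comul_cop_fun comul1 sw_pure //; lin. Qed.

Fact cop_antipodel h :
  \sw_(a, b <- comul_cop h) (antipode_inv a * b) = counit h *: 1.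
Proof.
rewrite sw_cop; last by lin.
apply: (can_inj SK); rewrite (sw_lin _ _ (@lin_app _ _ _ _ antipode _ (@lin_id _ _))).
rewrite linearZ /= antipode1 -antipodel; apply: eq_sw => a b.
by rewrite antipodeM SinvK.
Qed.

Fact cop_antipoder h :
  \sw_(a, b <- comul_cop h) (a * antipode_inv b) = counit h *: 1.
Proof.
rewrite sw_cop; last by lin.
apply: (can_inj SK); rewrite (sw_lin _ _ (@lin_app _ _ _ _ antipode _ (@lin_id _ _))).
rewrite linearZ /= antipode1 -antipoder; apply: eq_sw => a b.
by rewrite antipodeM SinvK.
Qed.

(** The carrier and the product are those of H, so that modules, bilinear forms
    and endomorphisms over H are at once objects over this Hopf algebra. *)
Definition coopposite : hopfAlgebra k :=
  HopfAlgebra cop_comulA cop_counitl cop_counitr cop_comulM cop_comul1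
    (@counitM k H) (@counit1 k H) cop_antipodel cop_antipoder.

(** The bridge between the two coproducts on the same carrier. *)
Lemma sw_coopposite U (h : coopposite) (F : coopposite -> coopposite -> U) : bilin F ->
  \sw_(a, b <- comul h) F a b = \sw_(a, b <- (comul (h : H) : (H ⊗ H)%type)) F b a.
Proof. exact: (@sw_cop U h F). Qed.

(** The inverse antipode is the antipode of the coopposite Hopf algebra. *)
Lemma comul_antipode_inv h :
  comul (antipode_inv h : H)
  = \sw_(a, b <- comul h) (antipode_inv b ⊗ antipode_inv a) :> (H ⊗ H)%type.
Proof.
have /(congr1 (fun t : (H ⊗ H)%type => \sw_(a, b <- t) (b ⊗ a))) :=
  @comul_antipode k coopposite h.
rewrite [in RHS]sw_coopposite; last by lin.
rewrite [in LHS]sw_coopposite; last by lin.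
rewrite sweedler_id => ->; rewrite sw_sw; last by lin.
by apply: eq_sw => a b; rewrite sw_pure //; lin.
Qed.

End Coopposite.

(** * The convolution inverse of a twisted action *)

Section Twisted.
Variables (k : fieldType) (H : hopfAlgebra k) (sigma tau : {scalar (H ⊗ H)%type}).
Hypotheses (sigma_lazy : lazy sigma) (sigma_inv : convolution_inverse sigma tau).
Implicit Types (U : lmodType k) (g h : H).



Fact cocycle_mul_bilin : bilin (cocycle_mul sigma).
Proof. by rewrite /cocycle_mul; lin. Qed.

(** Convolving the twisted product with tau on the left cancels sigma. *)
Lemma untwist_l x y :
  \sw_(x1, x2 <- comul x) \sw_(y1, y2 <- comul y)
    (tau (x1 ⊗ y1) *: cocycle_mul sigma x2 y2) = x * y.
Proof.
transitivity (\sw_(x1, x2 <- comul x) \sw_(x3, x4 <- comul x2)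
    \sw_(y1, y2 <- comul y) \sw_(y3, y4 <- comul y2)
      (tau (x1 ⊗ y1) *: (sigma (x3 ⊗ y3) *: (x4 * y4)))).
  apply: eq_sw => a b; rewrite [RHS]swC; apply: eq_sw => c d.
  rewrite swZ; apply: eq_sw => e f; exact: swZ.
rewrite -swA; last by lin.
rewrite -[x in RHS]counitl (sw_lin _ _ (@lin_mull _ _ _ _ y (@lin_id _ _))).
apply: eq_sw => a b.
under eq_sw => c d do [rewrite -swA; last by lin].
rewrite swC -[y in RHS]counitl (sw_lin _ _ (@lin_mulr _ _ _ _ _ (@lin_id _ _))).
apply: eq_sw => c d.
rewrite -scalerAl -scalerAr scalerA -(proj2 (sigma_inv a c)) sw_scal.
apply: eq_sw => e f; rewrite sw_scal.
by apply: eq_sw => i j; rewrite scalerA.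
Qed.

(** Laziness puts sigma at the end of the twisted product, where tau cancels it
    from the right. *)
Lemma untwist_r x y :
  \sw_(x1, x2 <- comul x) \sw_(y1, y2 <- comul y)
    (tau (x2 ⊗ y2) *: cocycle_mul sigma x1 y1) = x * y.
Proof.
transitivity (\sw_(x1, x2 <- comul x) \sw_(x3, x4 <- comul x1)
    \sw_(y1, y2 <- comul y) \sw_(y3, y4 <- comul y1)
      (tau (x2 ⊗ y2) *: (sigma (x4 ⊗ y4) *: (x3 * y3)))).
  apply: eq_sw => a b; rewrite [RHS]swC; apply: eq_sw => c d.
  rewrite /cocycle_mul sigma_lazy swZ; apply: eq_sw => e f; exact: swZ.
rewrite swA; last by lin.
rewrite -[x in RHS]counitr (sw_lin _ _ (@lin_mull _ _ _ _ y (@lin_id _ _))).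
apply: eq_sw => a b.
under eq_sw => c d do [rewrite swA; last by lin].
rewrite swC -[y in RHS]counitr (sw_lin _ _ (@lin_mulr _ _ _ _ _ (@lin_id _ _))).
apply: eq_sw => c d.
rewrite -scalerAl -scalerAr scalerA -(proj1 (sigma_inv b d)) sw_scal.
apply: eq_sw => e f; rewrite sw_scal.
by apply: eq_sw => i j; rewrite scalerA mulrC.
Qed.

(** The candidate for a right inverse of the identity of H(sigma); over the
    coopposite Hopf algebra it is the map S2, see [S1_right_coopposite]. *)
Definition S1_right h : H :=
  \sw_(h1, h' <- comul h) \sw_(h2, h3 <- comul h')
    (tau (h1 ⊗ antipode h2) *: antipode h3).

(** Apply [untwist_l] to x = S(h_1) and y = h_2: the coproduct of S(h_1) reverses
    the order, which is how the legs of tau come to be S(h_2) and h_3. *)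
Lemma S1_left_inverse h : \sw_(a, b <- comul h) cocycle_mul sigma (S1 tau a) b = counit h *: 1.
Proof.
have cmul_bilin := cocycle_mul_bilin.
transitivity (\sw_(a, b <- comul h) \sw_(c, d <- comul b) \sw_(e, f <- comul d)
   (tau (antipode c ⊗ e) *: cocycle_mul sigma (antipode a) f)).
  transitivity (\sw_(a, b <- comul h) \sw_(a1, a' <- comul a) \sw_(a2, a3 <- comul a')
    (tau (antipode a2 ⊗ a3) *: cocycle_mul sigma (antipode a1) b)).
    apply: eq_sw => a b; rewrite /S1 (sw_lin _ _ (proj1 cmul_bilin b)).
    apply: eq_sw => c d; rewrite (sw_lin _ _ (proj1 cmul_bilin b)).
    by apply: eq_sw => e f; rewrite (lin_homog (proj1 cmul_bilin b)).
  rewrite swA; last by lin.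
  by apply: eq_sw => a b; rewrite swA //; lin.
rewrite -antipodel.
transitivity (\sw_(a, b <- comul h) \sw_(a1, a2 <- comul a) \sw_(b1, b2 <- comul b)
   (tau (antipode a2 ⊗ b1) *: cocycle_mul sigma (antipode a1) b2)).
  by rewrite swA //; lin.
apply: eq_sw => a b; rewrite -untwist_l comul_antipode sw_sw; last by lin.
by apply: eq_sw => c d; rewrite sw_pure //; lin.
Qed.

(** Apply [untwist_r] to x = h_1 and y = S(h_2). *)
Lemma S1_right_inverse h : \sw_(a, b <- comul h) cocycle_mul sigma a (S1_right b) = counit h *: 1.
Proof.
have cmul_bilin := cocycle_mul_bilin; rewrite -antipoder.
transitivity (\sw_(a, b <- comul h) \sw_(c, d <- comul b) \sw_(e, f <- comul d)
   (tau (c ⊗ antipode e) *: cocycle_mul sigma a (antipode f))).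
  apply: eq_sw => a b; rewrite /S1_right (sw_lin _ _ (proj2 cmul_bilin a)).
  apply: eq_sw => c d; rewrite (sw_lin _ _ (proj2 cmul_bilin a)).
  by apply: eq_sw => e f; rewrite (lin_homog (proj2 cmul_bilin a)).
rewrite -swA; last by lin.
apply: eq_sw => a b; rewrite -untwist_r comul_antipode.
apply: eq_sw => c d; rewrite sw_sw; last by lin.
by apply: eq_sw => e f; rewrite sw_pure //; lin.
Qed.

Variables (M : lmodType k) (act : {linear (H ⊗ M)%type -> M}).
Hypothesis actM : is_left_module (cocycle_mul sigma) act.

Fact S1_bilin : bilin (fun h m => act (S1 tau h ⊗ m)).
Proof. by rewrite /S1; lin. Qed.

Fact S1_right_bilin : bilin (fun h m => act (S1_right h ⊗ m)).
Proof. by rewrite /S1_right; lin. Qed.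

Lemma act_S1_left h m :
  \sw_(a, b <- comul h) act (S1 tau a ⊗ act (b ⊗ m)) = counit h *: m.
Proof.
case: actM => act1 actA.
under eq_sw => a b do rewrite -actA.
pose f x := act (x ⊗ m); have fl : linear f by rewrite /f; lin.
by rewrite -(sw_lin _ _ fl) S1_left_inverse (lin_homog fl) /f act1.
Qed.

Lemma act_S1_right_form h m :
  \sw_(a, b <- comul h) act (a ⊗ act (S1_right b ⊗ m)) = counit h *: m.
Proof.
case: actM => act1 actA.
under eq_sw => a b do rewrite -actA.
pose f x := act (x ⊗ m); have fl : linear f by rewrite /f; lin.
by rewrite -(sw_lin _ _ fl) S1_right_inverse (lin_homog fl) /f act1.
Qed.

(** A left and a right convolution inverse of the action agree.  The comparison
    takes place among operators on M, where associativity is free, and not in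
    H(sigma). *)
Lemma act_S1E h m : act (S1 tau h ⊗ m) = act (S1_right h ⊗ m).
Proof.
rewrite (@conv_divr k H M M (fun h m => act (S1 tau h ⊗ m))
  (fun h m => counit h *: m) (fun h m => act (h ⊗ m))
  (fun h m => act (S1_right h ⊗ m))); [|exact: S1_bilin|by lin|by lin|exact: S1_right_bilin|
  exact: act_S1_right_form|exact: act_S1_left].
by rewrite sw_counitl //; case: S1_right_bilin.
Qed.

Lemma act_S1_right h m :
  \sw_(a, b <- comul h) act (a ⊗ act (S1 tau b ⊗ m)) = counit h *: m.
Proof. by rewrite -act_S1_right_form; apply: eq_sw => a b; rewrite act_S1E. Qed.

End Twisted.

Section TwistedCoopposite.
Variables (k : fieldType) (H : hopfAlgebra k).
Variables (Sinv : H -> H) (SK : cancel antipode Sinv) (SinvK : cancel Sinv antipode).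
Variables (sigma tau : {scalar (H ⊗ H)%type}).
Hypotheses (sigma_lazy : lazy sigma) (sigma_inv : convolution_inverse sigma tau).
Local Notation Hcop := (coopposite SK SinvK).
Local Notation si := (antipode_inv SK SinvK).

(** Laziness says that sigma may be convolved with the product on either side,
    that is, that the twisted product does not see which coproduct is used. *)
Lemma cocycle_mul_coopposite g h :
  @cocycle_mul k Hcop sigma g h = cocycle_mul sigma g h.
Proof.
rewrite /cocycle_mul sigma_lazy sw_coopposite; last by lin.
by apply: eq_sw => a b; rewrite sw_coopposite //; lin.
Qed.

Lemma lazy_coopposite : @lazy k Hcop sigma.
Proof.
move=> g h; transitivity (cocycle_mul sigma g h).
  exact: cocycle_mul_coopposite.
rewrite sw_coopposite; last by lin.
by apply: eq_sw => a b; rewrite sw_coopposite //; lin.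
Qed.

Lemma convolution_inverse_coopposite : @convolution_inverse k Hcop sigma tau.
Proof.
move=> /= g h; have [st ts] := sigma_inv g h.
have flip (s t : {scalar (H ⊗ H)%type}) :
    \sw_(g1, g2 <- (comul : Hcop -> (Hcop ⊗ Hcop)%type) g)
      \sw_(h1, h2 <- (comul : Hcop -> (Hcop ⊗ Hcop)%type) h) (s (g1 ⊗ h1) * t (g2 ⊗ h2))
    = \sw_(g1, g2 <- comul (g : H)) \sw_(h1, h2 <- comul (h : H)) (t (g1 ⊗ h1) * s (g2 ⊗ h2)).
  transitivity (\sw_(g1, g2 <- (comul : Hcop -> (Hcop ⊗ Hcop)%type) g)
      \sw_(h1, h2 <- (comul : Hcop -> (Hcop ⊗ Hcop)%type) h)
        (s (g1 ⊗ h1) *: (t (g2 ⊗ h2) *: (1 : k^o)))).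
    by do 2 (apply: eq_sw => ? ?); rewrite scalerA [RHS]mulr1.
  rewrite sw_coopposite; last by lin.
  apply: eq_sw => a b; rewrite sw_coopposite; last by lin.
  by apply: eq_sw => c d; rewrite scalerA [LHS]mulr1 mulrC.
by split; [rewrite -ts; exact: flip|rewrite -st; exact: flip].
Qed.

Lemma S1_right_coopposite h : @S1_right k Hcop tau h = S2 tau Sinv h.
Proof.
rewrite /S1_right sw_coopposite; last by lin.
under eq_sw => a b do [rewrite sw_coopposite; last by lin].
by rewrite (@swA _ _ _ _ (fun a b c => tau (c ⊗ si b) *: si a)) //; lin.
Qed.

Variables (M : lmodType k) (act : {linear (H ⊗ M)%type -> M}).
Hypothesis actM : is_left_module (cocycle_mul sigma) act.

Lemma module_coopposite : is_left_module (@cocycle_mul k Hcop sigma) act.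
Proof.
by case: actM => act1 actA; split=> // g h m; rewrite cocycle_mul_coopposite.
Qed.

Lemma act_S2E h m : act (S2 tau Sinv h ⊗ m) = act (@S1 k Hcop tau h ⊗ m).
Proof.
rewrite -S1_right_coopposite.
by rewrite [RHS](@act_S1E k Hcop sigma tau lazy_coopposite
  convolution_inverse_coopposite M act module_coopposite).
Qed.

Fact S2_bilin : bilin (fun h m => act (S2 tau Sinv h ⊗ m)).
Proof.
have := @S1_right_bilin k Hcop tau M act.
by case=> bl br; split=> [m a g h|h a u v]; rewrite -!S1_right_coopposite; [apply: bl|apply: br].
Qed.

(** Over the coopposite Hopf algebra, S2 plays the role of S1; the versions over H
    follow by exchanging the legs of the coproduct. *)
Lemma act_S2_left_cop (h : Hcop) m :
  \sw_(a, b <- comul h) act (S2 tau Sinv a ⊗ act (b ⊗ m)) = counit h *: m.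
Proof.
rewrite -[RHS](@act_S1_left k Hcop sigma tau
  convolution_inverse_coopposite M act module_coopposite).
by apply: eq_sw => a b; rewrite act_S2E.
Qed.

Lemma act_S2_right_cop (h : Hcop) m :
  \sw_(a, b <- comul h) act (a ⊗ act (S2 tau Sinv b ⊗ m)) = counit h *: m.
Proof.
rewrite -[RHS](@act_S1_right k Hcop sigma tau lazy_coopposite
  convolution_inverse_coopposite M act module_coopposite).
by apply: eq_sw => a b; rewrite act_S2E.
Qed.

Lemma act_S2_left h m :
  \sw_(a, b <- comul h) act (S2 tau Sinv b ⊗ act (a ⊗ m)) = counit h *: m.
Proof.
have S2b := S2_bilin.
rewrite -[RHS]act_S2_left_cop sw_coopposite //.
by split=> v; [exact: lin_bill S2b (@lin_id _ _)|exact: lin_bilr S2b (lin_app (lin_purel (@lin_id _ _)))].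
Qed.

Lemma act_S2_right h m :
  \sw_(a, b <- comul h) act (b ⊗ act (S2 tau Sinv a ⊗ m)) = counit h *: m.
Proof.
have S2b := S2_bilin.
rewrite -[RHS]act_S2_right_cop sw_coopposite //.
split=> v; first by lin.
exact: lin_app (lin_purer (lin_bill S2b (@lin_id _ _))).
Qed.

End TwistedCoopposite.

(** * The adjoint action on endomorphisms *)

(** Everything here is stated for an arbitrary convolution inverse Lbar of the
    action, to serve for S1 over H and for S2 over the coopposite of H. *)
Section Adjoint.
Variables (k : fieldType) (H : hopfAlgebra k) (sigma : {scalar (H ⊗ H)%type}).
Hypothesis sigma_lazy : lazy sigma.
Variables (M : vectType k) (act : {linear (H ⊗ M)%type -> M}).
Hypothesis actM : is_left_module (cocycle_mul sigma) act.
Variable Lbar : H -> M -> M.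
Hypotheses (Lbar_bilin : bilin Lbar)
  (Lbar_left : forall h m, \sw_(a, b <- comul h) Lbar a (act (b ⊗ m)) = counit h *: m)
  (Lbar_right : forall h m, \sw_(a, b <- comul h) act (a ⊗ Lbar b m) = counit h *: m).
Implicit Types (g h : H) (f : 'End(M)) (m : M).

Definition adj_fun h f m : M := \sw_(a, b <- comul h) act (a ⊗ f (Lbar b m)).

Fact adj_fun_lin h f : linear (adj_fun h f).
Proof. by rewrite /adj_fun; lin. Qed.

Definition adj h f : 'End(M) :=
  linfun (HB.pack (adj_fun h f)
    (GRing.isLinear.Build k M M *:%R (adj_fun h f) (adj_fun_lin h f))
    : {linear M -> M}).

Lemma adjE h f m : adj h f m = \sw_(a, b <- comul h) act (a ⊗ f (Lbar b m)).
Proof. by rewrite lfunE. Qed.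

Lemma adj_bilin : bilin adj.
Proof.
split=> [f a g h|h a f g]; apply/lfunP=> m; rewrite add_lfunE scale_lfunE !adjE.
  pose F h := \sw_(a, b <- comul h) act (a ⊗ f (Lbar b m)).
  have Fl : linear F by rewrite /F; lin.
  exact: Fl.
pose F f := \sw_(a, b <- comul h) act (a ⊗ f (Lbar b m)).
have Fl : linear F by rewrite /F; lin.
exact: Fl.
Qed.

Definition adj_act_fun (t : (H ⊗ 'End(M))%type) := sweedler t adj.

Fact adj_act_lin : linear adj_act_fun.
Proof. by case: adj_bilin => Fl Fr; exact: sweedler_linear. Qed.

Definition adj_act : {linear (H ⊗ 'End(M))%type -> 'End(M)} :=
  HB.pack adj_act_fun (GRing.isLinear.Build k _ _ *:%R adj_act_fun adj_act_lin).

Lemma adj_actE h f : adj_act (h ⊗ f) = adj h f.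
Proof. exact/sw_pure/adj_bilin. Qed.

(** This property characterises the adjoint action, by [conv_divr]. *)
Lemma adj_intertwines h f m :
  \sw_(a, b <- comul h) adj a f (act (b ⊗ m)) = act (h ⊗ f m).
Proof.
under eq_sw => a b do rewrite adjE.
rewrite swA; last by lin.
rewrite -(@sw_counitr _ _ _ h (fun x => act (x ⊗ f m))); last by lin.
apply: eq_sw => a b.
pose F n := act (a ⊗ f n); have Fl : linear F by rewrite /F; lin.
by rewrite -(sw_lin _ _ Fl) Lbar_left (lin_homog Fl).
Qed.

(** The product of the action is the untwisted one: after dividing by L(g) and
    L(h), laziness lets sigma(g_2, h_2) leave the expression that depends on the
    products g_1 h_1 only. *)
Lemma adjM g h f : adj (g * h) f = adj g (adj h f).
Proof.
have adjb := adj_bilin.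
apply/lfunP=> m; rewrite [RHS]adjE.
apply: (@conv_divr k H M M (fun g m => adj (g * h) f m)
  (fun g m => act (g ⊗ adj h f m)) (fun h m => act (h ⊗ m)) Lbar) => //; try by lin.
(* This was the division by L(g); the next one is by L(h), with g fixed. *)
move=> {}g {}m; rewrite adjE.
pose act_g n := act (g ⊗ n); have act_gl : linear act_g by rewrite /act_g; lin.
rewrite -/(act_g _) (sw_lin _ _ act_gl) /act_g.
apply: (@conv_divr k H M M
  (fun h m => \sw_(a, b <- comul g) adj (a * h) f (act (b ⊗ m)))
  (fun h m => act (g ⊗ act (h ⊗ f m))) (fun h m => act (h ⊗ m)) Lbar) => //; try by lin.
move=> {m}h m; case: actM => _ actA.
pose F x := act (x ⊗ f m); have Fl : linear F by rewrite /F; lin.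
rewrite -actA -/(F _) /cocycle_mul sigma_lazy (sw_lin _ _ Fl).
rewrite swC.
transitivity (\sw_(a, b <- comul g) \sw_(b1, b2 <- comul b)
   \sw_(c, d <- comul h) \sw_(d1, d2 <- comul d)
     (sigma (b2 ⊗ d2) *: adj (a * c) f (act ((b1 * d1) ⊗ m)))).
  apply: eq_sw => a b; rewrite [RHS]swC; apply: eq_sw => c d.
  pose G x := adj (a * c) f (act (x ⊗ m)); have Gl : linear G by rewrite /G; lin.
  rewrite -actA -/(G _) /cocycle_mul sigma_lazy (sw_lin _ _ Gl).
  apply: eq_sw => a' b'; rewrite (sw_lin _ _ Gl).
  by apply: eq_sw => c' d'; rewrite (lin_homog Gl).
rewrite -swA; last by lin.
apply: eq_sw => a b; rewrite (sw_lin _ _ Fl).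
under eq_sw => a1 a2 do [rewrite -swA; last by lin].
rewrite swC; apply: eq_sw => c d.
rewrite (lin_homog Fl) /F -adj_intertwines comulM sw_sw; last by lin.
rewrite swZ; apply: eq_sw => a1 a2; rewrite sw_sw; last by lin.
by rewrite swZ; apply: eq_sw => c1 c2; rewrite sw_pure //; lin.
Qed.

Lemma adj1 f : adj 1 f = f.
Proof.
apply/lfunP=> m; rewrite adjE comul1 sw_pure; last by lin.
case: actM => act1 _; rewrite act1; congr (f _).
have := Lbar_left 1 m; rewrite comul1 sw_pure; last by lin.
by rewrite act1 counit1 scale1r.
Qed.

Lemma adj_module : is_left_module (fun g h : H => g * h) adj_act.
Proof. by split=> [f|g h f]; rewrite !adj_actE ?adj1 ?adjM. Qed.

(** The factor Lbar(h_2) L(h_3) that appears between the two endomorphisms is a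
    counit. *)
Lemma adj_comp h f f' :
  adj h (f \o f')%VF = \sw_(a, b <- comul h) (adj a f \o adj b f')%VF.
Proof.
have adjb := adj_bilin.
apply/lfunP=> m; pose ev (F : 'End(M)) := F m.
have evl : linear ev by rewrite /ev; lin.
rewrite -[RHS]/(ev _) (sw_lin _ _ evl) /ev.
transitivity (\sw_(a, b <- comul h) \sw_(c, d <- comul b)
    adj a f (act (c ⊗ f' (Lbar d m)))).
  rewrite -swA; last by lin.
  rewrite adjE; apply: eq_sw => a b.
  by rewrite comp_lfunE adj_intertwines.
apply: eq_sw => a b; rewrite comp_lfunE [adj b _ _]adjE.
by rewrite (sw_lin _ _ (linearP (adj a f))).
Qed.

Lemma adj_id h : adj h \1%VF = counit h *: \1%VF.
Proof.
apply/lfunP=> m; rewrite adjE scale_lfunE id_lfunE -Lbar_right.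
by apply: eq_sw => a b; rewrite id_lfunE.
Qed.

End Adjoint.

(** * The coaction on endomorphisms *)

Section Coaction.
Variables (k : fieldType) (H : hopfAlgebra k) (M : vectType k).
Variable rho : {linear M -> (M ⊗ H)%type}.
Hypothesis rhoM : is_right_comodule rho.
Implicit Types (U : lmodType k) (g h : H) (f : 'End(M)) (m : M).

Lemma sw_coassoc U m (F : M -> H -> H -> U) : trilin F ->
  \sw_(a, b <- rho m) \sw_(a1, a2 <- rho a) F a1 a2 b
  = \sw_(a, b <- rho m) \sw_(b1, b2 <- comul b) F a b1 b2.
Proof.
move=> Ft; have Fb := sw3 Ft; case: (Ft) => F1 F2 F3; case: rhoM => _ rhoA.
pose phi t := \sw_(u, c <- t) \sw_(a, b <- u) F a b c.
transitivity (phi (\sw_(a, b <- rho m) \sw_(a1, a2 <- rho a) (a1 ⊗ a2 ⊗ b))).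
  rewrite /phi sw_sw //; apply: eq_sw => a b; rewrite sw_sw //; apply: eq_sw => c d.
  by rewrite !sw_pure //; lin.
rewrite rhoA /phi sw_sw //; apply: eq_sw => a b; rewrite sw_sw //.
by apply: eq_sw => c d; rewrite !sw_pure //; lin.
Qed.

Lemma sw_rho_counit U m (F : M -> U) : linear F ->
  \sw_(a, b <- rho m) (counit b *: F a) = F m.
Proof.
case: rhoM => rho1 _ Fl; rewrite -[in RHS](rho1 m) (sw_lin _ _ Fl).
by apply: eq_sw => a b; rewrite (lin_homog Fl).
Qed.

(** The endomorphism e_i^* (x) n for the basis e of M; these turn a linear map
    M -> M (x) H into an element of End(M) (x) H. *)
Definition rank1_fun i (n m : M) := coord (vbasis {:M}) i m *: n.

Fact rank1_lin i n : linear (rank1_fun i n).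
Proof. by move=> a u v; rewrite /rank1_fun linearP scalerDl scalerA. Qed.

Definition rank1 i n : 'End(M) :=
  linfun (HB.pack (rank1_fun i n)
    (GRing.isLinear.Build k M M *:%R (rank1_fun i n) (rank1_lin i n))
    : {linear M -> M}).

Lemma rank1E i n m : rank1 i n m = coord (vbasis {:M}) i m *: n.
Proof. by rewrite lfunE. Qed.

Fact rank1_linr i : linear (rank1 i).
Proof.
move=> a u v; apply/lfunP=> m; rewrite add_lfunE scale_lfunE !rank1E.
by rewrite scalerDr !scalerA mulrC.
Qed.

(** The two coactions on End(M) are treated together: mu(x, y) is S^-1(x) y in
    one case and y S(x) in the other. *)
Variable mu : H -> H -> H.
Hypothesis mu_bilin : bilin mu.

Definition end_rho_fun f : ('End(M) ⊗ H)%type :=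
  \sum_(i < \dim {:M}) \sw_(m0, m1 <- rho (vbasis {:M})`_i) \sw_(n0, n1 <- rho (f m0))
    (rank1 i n0 ⊗ mu m1 n1).

Fact end_rho_lin : linear end_rho_fun.
Proof.
have r1 := rank1_linr.
move=> a f g; rewrite /end_rho_fun scaler_sumr -big_split /=; apply: eq_bigr => i _.
pose F f := \sw_(m0, m1 <- rho (vbasis {:M})`_i) \sw_(n0, n1 <- rho (f m0))
    (rank1 i n0 ⊗ mu m1 n1).
have Fl : linear F by rewrite /F; lin; apply: lin_purel; apply: r1.
exact: Fl.
Qed.

Definition end_rho : {linear 'End(M) -> ('End(M) ⊗ H)%type} :=
  HB.pack end_rho_fun (GRing.isLinear.Build k _ _ *:%R end_rho_fun end_rho_lin).

(** The defining formula of the coaction, in the form in which it is applied: only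
    the values f_0(m) are accessible, and they suffice. *)
Lemma sw_end_rho U f m (G : M -> H -> U) : bilin G ->
  \sw_(f0, f1 <- end_rho f) G (f0 m) f1
  = \sw_(m0, m1 <- rho m) \sw_(n0, n1 <- rho (f m0)) G n0 (mu m1 n1).
Proof.
move=> Gb.
have Gb' : bilin (fun (f0 : 'End(M)) (f1 : H) => G (f0 m) f1) by lin.
case: (Gb') => Gl' Gr'.
rewrite /= /end_rho_fun (linear_sum_of (sweedler_linear Gl' Gr')).
pose F m := \sw_(m0, m1 <- rho m) \sw_(n0, n1 <- rho (f m0)) G n0 (mu m1 n1).
have Fl : linear F by rewrite /F; lin.
rewrite -/(F m) {2}(coord_vbasis (memvf m)) (linear_sum_of Fl).
apply: eq_bigr => i _; rewrite (lin_homog Fl) /F swZ sw_sw //.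
apply: eq_sw => m0 m1; rewrite swZ sw_sw //; apply: eq_sw => n0 n1.
by rewrite sw_pure // rank1E (lin_homog (proj1 Gb _)).
Qed.

Definition tens_assoc (A B C : lmodType k) (t : (A ⊗ B ⊗ C)%type)
  : (A ⊗ (B ⊗ C))%type := \sw_(u, c <- t) \sw_(a, b <- u) (a ⊗ (b ⊗ c)).

Definition tens_assocV (A B C : lmodType k) (t : (A ⊗ (B ⊗ C))%type)
  : (A ⊗ B ⊗ C)%type := \sw_(a, u <- t) \sw_(b, c <- u) (a ⊗ b ⊗ c).

Lemma tens_assocK (A B C : lmodType k) : cancel (@tens_assoc A B C) (@tens_assocV A B C).
Proof.
move=> t; rewrite /tens_assoc /tens_assocV sw_sw; last by lin.
rewrite -[RHS]sweedler_id; apply: eq_sw => u c; rewrite sw_sw; last by lin.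
rewrite -[in RHS](sweedler_id u) (sw_lin _ _ (@lin_purel _ _ _ _ _ c (@lin_id _ _))).
apply: eq_sw => a b; rewrite !sw_pure //; lin.
Qed.

(** Reduces to [tensor_end_inj] with coefficients in H (x) H. *)
Lemma tensor_end_inj3 (x y : ('End(M) ⊗ H ⊗ H)%type) :
  (forall m, \sw_(t, c <- x) \sw_(f, b <- t) (f m ⊗ b ⊗ c)
           = \sw_(t, c <- y) \sw_(f, b <- t) (f m ⊗ b ⊗ c)) -> x = y.
Proof.
move=> xy; apply: (can_inj (@tens_assocK _ _ _)); apply: tensor_end_inj => m.
have E (z : ('End(M) ⊗ H ⊗ H)%type) : \sw_(f, h <- tens_assoc z) (f m ⊗ h)
    = tens_assoc (\sw_(t, c <- z) \sw_(f, b <- t) (f m ⊗ b ⊗ c)).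
  rewrite /tens_assoc !sw_sw; try by lin.
  apply: eq_sw => t c; rewrite !sw_sw; try by lin.
  by apply: eq_sw => f b; rewrite !sw_pure //; lin.
by rewrite !E xy.
Qed.

(** In its first argument mu reverses the coproduct, as the antipode and its
    inverse do. *)
Hypothesis counit_mu : forall x y, counit (mu x y) = counit x * counit y.
Hypothesis comul_mu : forall x y, comul (mu x y)
  = \sw_(a, b <- comul x) \sw_(c, d <- comul y) (mu b c ⊗ mu a d).

Lemma end_rho_comodule : is_right_comodule end_rho.
Proof.
split=> f.
  apply/lfunP=> m; pose ev (F : 'End(M)) := F m.
  have evl : linear ev by rewrite /ev; lin.
  rewrite -[LHS]/(ev _) (sw_lin _ _ evl).
  transitivity (\sw_(f0, f1 <- end_rho f) (counit f1 *: f0 m)).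
    by apply: eq_sw => f0 f1; rewrite /ev scale_lfunE.
  rewrite (sw_end_rho f m (G := fun n h => counit h *: n)); last by lin.
  rewrite -[RHS](@sw_rho_counit _ m f); last exact: lin_lfun (@lin_id _ _).
  apply: eq_sw => m0 m1.
  rewrite -[in RHS](@sw_rho_counit _ (f m0) id) // swZ; apply: eq_sw => n0 n1.
  by rewrite counit_mu scalerA.
apply: tensor_end_inj3 => m; rewrite !sw_sw; try by lin.
transitivity (\sw_(f0, f1 <- end_rho f) \sw_(m0, m1 <- rho m)
    \sw_(n0, n1 <- rho (f0 m0)) (n0 ⊗ mu m1 n1 ⊗ f1)).
  apply: eq_sw => f0 f1.
  rewrite -(sw_end_rho f0 m (G := fun n h => n ⊗ h ⊗ f1)); last by lin.
  rewrite sw_sw; last by lin.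
  by apply: eq_sw => f00 f01; rewrite !sw_pure //; lin.
rewrite swC.
transitivity (\sw_(m0, m1 <- rho m) \sw_(m00, m01 <- rho m0)
    \sw_(n0, n1 <- rho (f m00)) \sw_(n00, n01 <- rho n0)
      (n00 ⊗ mu m1 n01 ⊗ mu m01 n1)).
  apply: eq_sw => m0 m1.
  by rewrite (sw_end_rho f m0 (G := fun n h =>
     \sw_(n0, n1 <- rho n) (n0 ⊗ mu m1 n1 ⊗ h))) //; lin.
rewrite sw_coassoc; last by lin.
transitivity (\sw_(f0, f1 <- end_rho f) \sw_(h1, h2 <- comul f1) (f0 m ⊗ h1 ⊗ h2)).
  rewrite (sw_end_rho f m (G := fun n h => \sw_(h1, h2 <- comul h) (n ⊗ h1 ⊗ h2)));
    last by lin.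
  apply: eq_sw => m0 m1.
  under eq_sw => c d do [rewrite sw_coassoc; last by lin].
  rewrite swC; apply: eq_sw => n0 n1.
  rewrite comul_mu sw_sw; last by lin.
  apply: eq_sw => a b; rewrite sw_sw; last by lin.
  by apply: eq_sw => c d; rewrite sw_pure //; lin.
apply: eq_sw => f0 f1; rewrite sw_sw; last by lin.
by apply: eq_sw => c d; rewrite !sw_pure //; lin.
Qed.

(** With nu the product of H or its opposite, the middle factors S^-1(y_1) and
    y_2, respectively S(y_1) and y_2, meet in the right order to cancel. *)
Variable nu : H -> H -> H.
Hypothesis nu_bilin : bilin nu.
Hypothesis mu_diag : forall x, \sw_(a, b <- comul x) mu b a = counit x *: 1.
Hypothesis mu_nu : forall x y z,
  \sw_(a, b <- comul y) nu (mu x b) (mu a z) = counit y *: mu x z.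

Lemma end_rho_id : end_rho \1%VF = \1%VF ⊗ 1.
Proof.
apply: tensor_end_inj => m.
rewrite (sw_end_rho _ m (G := fun n h => n ⊗ h)); last by lin.
rewrite sw_pure; last by lin.
under eq_sw => a b do rewrite id_lfunE.
rewrite (@sw_coassoc _ m (fun a b c => a ⊗ mu c b)); last by lin.
rewrite id_lfunE -[RHS](@sw_rho_counit _ m (fun n => n ⊗ 1)); last by lin.
apply: eq_sw => m0 m1; rewrite -(sw_lin _ _ (pure_linearr m0)) mu_diag.
exact: (lin_homog (pure_linearr m0)).
Qed.

Lemma end_rho_comp f (g : 'End(M)) : end_rho (f \o g)%VF
  = \sw_(f0, f1 <- end_rho f) \sw_(g0, g1 <- end_rho g) ((f0 \o g0)%VF ⊗ nu g1 f1).
Proof.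
apply: tensor_end_inj => m.
rewrite (sw_end_rho _ m (G := fun n h => n ⊗ h)); last by lin.
rewrite sw_sw; last by lin.
transitivity (\sw_(g0, g1 <- end_rho g) \sw_(f0, f1 <- end_rho f)
    (f0 (g0 m) ⊗ nu g1 f1)); last first.
  rewrite swC; apply: eq_sw => f0 f1; rewrite sw_sw; last by lin.
  apply: eq_sw => g0 g1; rewrite sw_pure ?comp_lfunE //; lin.
transitivity (\sw_(g0, g1 <- end_rho g) \sw_(n0, n1 <- rho (g0 m))
    \sw_(p0, p1 <- rho (f n0)) (p0 ⊗ nu g1 (mu n1 p1))); last first.
  apply: eq_sw => g0 g1.
  by rewrite (sw_end_rho f (g0 m) (G := fun n h => n ⊗ nu g1 h)) //; lin.
rewrite (sw_end_rho g m (G := fun n h => \sw_(n0, n1 <- rho n)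
    \sw_(p0, p1 <- rho (f n0)) (p0 ⊗ nu h (mu n1 p1)))); last by lin.
apply: eq_sw => m0 m1; rewrite sw_coassoc; last by lin.
rewrite comp_lfunE.
rewrite -[LHS](@sw_rho_counit _ (g m0) (fun n => \sw_(p0, p1 <- rho (f n))
   (p0 ⊗ mu m1 p1))); last by lin.
apply: eq_sw => n0 n1; rewrite swC swZ; apply: eq_sw => p0 p1.
rewrite -(sw_lin _ _ (pure_linearr p0)) mu_nu.
by rewrite (lin_homog (pure_linearr p0)).
Qed.

End Coaction.

Section AntipodeProducts.
Variables (k : fieldType) (H : hopfAlgebra k).
Variables (Sinv : H -> H) (SK : cancel antipode Sinv) (SinvK : cancel Sinv antipode).
Local Notation si := (antipode_inv SK SinvK).

Lemma counit_antipode_inv_mul (x y : H) : counit (si x * y) = counit x * counit y.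
Proof. by rewrite counitM; congr (_ * _); exact: (@counit_antipode k (coopposite SK SinvK)). Qed.

Lemma comul_antipode_inv_mul (x y : H) : comul (si x * y)
  = \sw_(a, b <- comul x) \sw_(c, d <- comul y) ((si b * c) ⊗ (si a * d)).
Proof.
rewrite comulM comul_antipode_inv sw_sw; last by lin.
by apply: eq_sw => a b; rewrite sw_pure //; lin.
Qed.

Lemma counit_mul_antipode (x y : H) : counit (y * antipode x) = counit x * counit y.
Proof. by rewrite counitM counit_antipode mulrC. Qed.

Lemma comul_mul_antipode (x y : H) : comul (y * antipode x)
  = \sw_(a, b <- comul x) \sw_(c, d <- comul y) ((c * antipode b) ⊗ (d * antipode a)).
Proof.
rewrite comulM comul_antipode [RHS]swC; apply: eq_sw => c d.
rewrite sw_sw; last by lin.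
by apply: eq_sw => a b; rewrite sw_pure //; lin.
Qed.

End AntipodeProducts.

(** * Yetter-Drinfeld compatibility *)

Section Compatibility.
Variables (k : fieldType) (H : hopfAlgebra k).
Variables (Sinv : H -> H) (SK : cancel antipode Sinv) (SinvK : cancel Sinv antipode).
Variables (M : vectType k) (act : {linear (H ⊗ M)%type -> M}).
Variable rho : {linear M -> (M ⊗ H)%type}.
Hypothesis YD : YD_compatible act rho.
Implicit Types (U : lmodType k) (g h : H) (f : 'End(M)) (m : M).

Let si : {linear H -> H} := antipode_inv SK SinvK.
Let S : {linear H -> H} := @antipode k H.

Let siM g h : si (g * h) = si h * si g.
Proof. exact: (@antipodeM k (coopposite SK SinvK)). Qed.

Let SM g h : S (g * h) = S h * S g.
Proof. exact: antipodeM. Qed.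

Lemma sw_antipode_invl U h (F : H -> U) : linear F ->
  \sw_(a, b <- comul h) F (si b * a) = counit h *: F 1.
Proof.
move=> Fl; rewrite -(lin_homog Fl) -(cop_antipodel SK SinvK) sw_cop; last by lin.
by rewrite (sw_lin _ _ Fl).
Qed.

Lemma sw_antipode_invr U h (F : H -> U) : linear F ->
  \sw_(a, b <- comul h) F (b * si a) = counit h *: F 1.
Proof.
move=> Fl; rewrite -(lin_homog Fl) -(cop_antipoder SK SinvK) sw_cop; last by lin.
by rewrite (sw_lin _ _ Fl).
Qed.

Lemma sw_YD U h m (G : M -> H -> U) : bilin G ->
  \sw_(a, b <- comul h) \sw_(m0, m1 <- rho m) G (act (a ⊗ m0)) (b * m1)
  = \sw_(a, b <- comul h) \sw_(n0, n1 <- rho (act (b ⊗ m))) G n0 (n1 * a).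
Proof.
move=> Gb; have /(congr1 (fun t => sweedler t G)) := YD h m.
rewrite !sw_sw // => E.
transitivity (\sw_(h1, h2 <- comul h)
      \sw_(c, d <- \sw_(m0, m1 <- rho m) act (h1 ⊗ m0) ⊗ (h2 * m1)) G c d).
  apply: eq_sw => a b; rewrite sw_sw //.
  by apply: eq_sw => c d; rewrite sw_pure.
rewrite E; apply: eq_sw => a b; rewrite sw_sw //.
by apply: eq_sw => c d; rewrite sw_pure.
Qed.

(** How the coaction moves past Lbar, for T the antipode or its inverse.  The
    relation between [twisted_rho] and [inv_rho] is proved below in the two
    cases, from different forms of the compatibility condition. *)
Section InverseCoaction.
Variables (T : {linear H -> H}) (Lbar : H -> M -> M).
Hypothesis Lbar_bilin : bilin Lbar.

Definition twisted_rho m : (M ⊗ H)%type := \sw_(m0, m1 <- rho m) (m0 ⊗ T m1).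

Definition inv_rho h m : (M ⊗ H)%type :=
  \sw_(a, b <- comul h) \sw_(c, d <- comul b) \sw_(m0, m1 <- rho m)
    (Lbar c m0 ⊗ (si d * (T m1 * a))).

Fact twisted_rho_lin : linear twisted_rho.
Proof. by rewrite /twisted_rho; lin. Qed.

Fact inv_rho_bilin : bilin inv_rho.
Proof. by rewrite /inv_rho; lin. Qed.

Hypothesis inv_rhoE : forall h m, twisted_rho (Lbar h m) = inv_rho h m.

(** Once [inv_rho] is expanded, the factor b is the leg h_4 and stands to the left
    of S^-1(h_3); these two cancel. *)
Lemma sw_inverse_coaction U h m (G : M -> H -> U) : bilin G ->
  \sw_(a, b <- comul h) \sw_(n0, n1 <- rho (Lbar a m)) G n0 (b * T n1)
  = \sw_(a, b <- comul h) \sw_(m0, m1 <- rho m) G (Lbar b m0) (T m1 * a).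
Proof.
move=> Gb.
transitivity (\sw_(a, b <- comul h) \sw_(n0, x <- twisted_rho (Lbar a m)) G n0 (b * x)).
  apply: eq_sw => a b; rewrite sw_sw; last by lin.
  by apply: eq_sw => c d; rewrite sw_pure //; lin.
transitivity (\sw_(a, b <- comul h) \sw_(a1, a' <- comul a) \sw_(a2, a3 <- comul a')
   \sw_(m0, m1 <- rho m) G (Lbar a2 m0) (b * (si a3 * (T m1 * a1)))).
  apply: eq_sw => a b; rewrite inv_rhoE sw_sw; last by lin.
  apply: eq_sw => a1 a'; rewrite sw_sw; last by lin.
  apply: eq_sw => a2 a3; rewrite sw_sw; last by lin.
  by apply: eq_sw => c d; rewrite sw_pure //; lin.
rewrite swA; last by lin.
apply: eq_sw => a x; rewrite swA; last by lin.
rewrite -[RHS](@sw_counitr _ _ _ x (fun c => \sw_(m0, m1 <- rho m) G (Lbar c m0) (T m1 * a)));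
  last by lin.
apply: eq_sw => b y; rewrite swC swZ; apply: eq_sw => m0 m1.
rewrite -{2}[T m1]mul1r -mulrA.
rewrite -(@sw_antipode_invr _ _ (fun x => G (Lbar b m0) (x * (T m1 * a)))); last by lin.
by apply: eq_sw => c d; rewrite !mulrA.
Qed.

End InverseCoaction.

Section Left.
Variable Lbar : H -> M -> M.
Hypothesis Lbar_bilin : bilin Lbar.
Hypotheses
  (Lbar_left : forall h m, \sw_(a, b <- comul h) Lbar a (act (b ⊗ m)) = counit h *: m)
  (Lbar_right : forall h m, \sw_(a, b <- comul h) act (a ⊗ Lbar b m) = counit h *: m).

(** Divide by L: in Lbar(h_2)n_0 (x) S^-1(h_3) S^-1(n_1) h_1 with n = L(h_4)m, the
    legs h_3 and h_4 meet in the form required by the compatibility of M.  It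
    replaces n_0 by L(h_3)m_0, and Lbar(h_2) L(h_3) cancels. *)
Lemma inv_rho_left h m : twisted_rho si (Lbar h m) = inv_rho si Lbar h m.
Proof.
have tl := twisted_rho_lin si; have ib := inv_rho_bilin si Lbar_bilin.
rewrite (@conv_divr k H M _ (inv_rho si Lbar) (fun h m => counit h *: twisted_rho si m)
   (fun h m => act (h ⊗ m)) Lbar) => [|||||//|x n]; try by lin.
  by rewrite sw_counitl //; lin.
transitivity (\sw_(a, b <- comul x) \sw_(a1, a' <- comul a) \sw_(a2, a3 <- comul a')
   \sw_(n0, n1 <- rho (act (b ⊗ n))) (Lbar a2 n0 ⊗ (si a3 * (si n1 * a1)))) => //.
rewrite swA; last by lin.
transitivity (\sw_(a, y <- comul x) \sw_(m0, m1 <- rho n) (m0 ⊗ (si m1 * (si y * a)))).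
  apply: eq_sw => a y; rewrite swA; last by lin.
  transitivity (\sw_(b, z <- comul y) \sw_(c, d <- comul z) \sw_(m0, m1 <- rho n)
      (Lbar b (act (c ⊗ m0)) ⊗ (si m1 * (si d * a)))).
    apply: eq_sw => b z.
    have -> : \sw_(c, d <- comul z) \sw_(m0, m1 <- rho n)
        (Lbar b (act (c ⊗ m0)) ⊗ (si m1 * (si d * a)))
      = \sw_(c, d <- comul z) \sw_(m0, m1 <- rho n)
        (Lbar b (act (c ⊗ m0)) ⊗ (si (d * m1) * a)).
      by apply: eq_sw => c d; apply: eq_sw => m0 m1; rewrite siM mulrA.
    rewrite (@sw_YD _ z n (fun n x => Lbar b n ⊗ (si x * a))); last by lin.
    by apply: eq_sw => c d; apply: eq_sw => m0 m1; rewrite siM mulrA.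
  rewrite -swA; last by lin.
  rewrite -[RHS](@sw_counitl _ _ _ y (fun d => \sw_(m0, m1 <- rho n)
    (m0 ⊗ (si m1 * (si d * a))))); last by lin.
  apply: eq_sw => u d; rewrite swC swZ; apply: eq_sw => m0 m1.
  rewrite -(sw_lin _ _ (pure_linearl (si m1 * (si d * a)))) Lbar_left.
  by rewrite (lin_homog (pure_linearl _)).
rewrite swC /twisted_rho swZ; apply: eq_sw => m0 m1.
rewrite (@sw_antipode_invl _ _ (fun x => m0 ⊗ (si m1 * x))) ?mulr1 //; lin.
Qed.

Variable actE : {linear (H ⊗ 'End(M))%type -> 'End(M)}.
Hypothesis actE_E : forall h f m, actE (h ⊗ f) m
  = \sw_(a, b <- comul h) act (a ⊗ f (Lbar b m)).
Variable rhoE : {linear 'End(M) -> ('End(M) ⊗ H)%type}.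
Hypothesis sw_rhoE : forall U f m (G : M -> H -> U), bilin G ->
  \sw_(f0, f1 <- rhoE f) G (f0 m) f1
  = \sw_(m0, m1 <- rho m) \sw_(n0, n1 <- rho (f m0)) G n0 (si m1 * n1).

(** Evaluated at m, the left side contains the coaction of Lbar(h_2)m next to h_3,
    which [sw_inverse_coaction] rewrites, and the right side contains the coaction
    of L(h_2) f(Lbar(h_3)m_0) next to h_1, which the compatibility of M rewrites. *)
Lemma end_YD_left : YD_compatible actE rhoE.
Proof.
move=> h f; apply: tensor_end_inj => m; rewrite !sw_sw; try by lin.
transitivity (\sw_(c, x <- comul h) \sw_(d, b <- comul x) \sw_(m0, m1 <- rho m)
    \sw_(n0, n1 <- rho (f (Lbar b m0))) (act (c ⊗ n0) ⊗ ((si m1 * d) * n1))).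
  transitivity (\sw_(a, b <- comul h) \sw_(c, d <- comul a)
      \sw_(m0, m1 <- rho (Lbar d m)) \sw_(n0, n1 <- rho (f m0))
        (act (c ⊗ n0) ⊗ (b * (si m1 * n1)))).
    apply: eq_sw => a b; rewrite sw_sw; last by lin.
    transitivity (\sw_(f0, f1 <- rhoE f) \sw_(c, d <- comul a)
        (act (c ⊗ f0 (Lbar d m)) ⊗ (b * f1))).
      apply: eq_sw => f0 f1; rewrite sw_pure; last by lin.
      by rewrite actE_E (sw_lin _ _ (pure_linearl _)).
    rewrite swC; apply: eq_sw => c d.
    by rewrite (sw_rhoE f (Lbar d m) (G := fun n x => act (c ⊗ n) ⊗ (b * x))) //; lin.
  rewrite swA; last by lin.
  apply: eq_sw => c x.
  transitivity (\sw_(d, b <- comul x) \sw_(m0, m1 <- rho (Lbar d m))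
     \sw_(n0, n1 <- rho (f m0)) (act (c ⊗ n0) ⊗ ((b * si m1) * n1))).
    by do 3 (apply: eq_sw => ? ?); rewrite !mulrA.
  by rewrite (sw_inverse_coaction Lbar_bilin inv_rho_left x m (G := fun p y =>
    \sw_(n0, n1 <- rho (f p)) (act (c ⊗ n0) ⊗ (y * n1)))) //; lin.
transitivity (\sw_(a, b <- comul h) \sw_(c, d <- comul b) \sw_(m0, m1 <- rho m)
    \sw_(n0, n1 <- rho (act (c ⊗ f (Lbar d m0)))) (n0 ⊗ (si m1 * (n1 * a)))); last first.
  apply: eq_sw => a b; rewrite sw_sw; last by lin.
  transitivity (\sw_(f0, f1 <- rhoE (actE (b ⊗ f))) (f0 m ⊗ (f1 * a))); last first.
    by apply: eq_sw => f0 f1; rewrite sw_pure //; lin.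
  rewrite (sw_rhoE _ m (G := fun n x => n ⊗ (x * a))); last by lin.
  rewrite swC; apply: eq_sw => m0 m1; rewrite actE_E.
  rewrite (sw_lin _ _ (linearP rho)) sw_sw; last by lin.
  by do 2 (apply: eq_sw => ? ?); rewrite !mulrA.
rewrite -swA; last by lin.
rewrite -[RHS]swA; last by lin.
apply: eq_sw => u d; rewrite swC [RHS]swC; apply: eq_sw => m0 m1.
rewrite -(@sw_YD _ u _ (fun n x => n ⊗ (si m1 * x))); last by lin.
by do 2 (apply: eq_sw => ? ?); rewrite !mulrA.
Qed.

End Left.

Section Right.
Variable Lbar : H -> M -> M.
Hypothesis Lbar_bilin : bilin Lbar.
Hypotheses
  (Lbar_left : forall h m, \sw_(a, b <- comul h) Lbar b (act (a ⊗ m)) = counit h *: m)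
  (Lbar_right : forall h m, \sw_(a, b <- comul h) act (b ⊗ Lbar a m) = counit h *: m).

(** The compatibility of M carries h_1 on the right of the coaction of L(h_2)m.
    Applying S and multiplying by h_0 on the left and h_3 on the right frees one
    side and leaves a form where L takes the first leg. *)
Lemma twisted_YD U h m (G : M -> H -> U) : bilin G ->
  \sw_(a, b <- comul h) \sw_(n0, n1 <- rho (act (a ⊗ m))) G n0 (S n1 * b)
  = \sw_(a, b <- comul h) \sw_(m0, m1 <- rho m) G (act (b ⊗ m0)) (a * S m1).
Proof.
move=> Gb.
transitivity (\sw_(a, u <- comul h) \sw_(b, v <- comul u) \sw_(c, d <- comul v)
   \sw_(n0, n1 <- rho (act (c ⊗ m))) G n0 (a * (S b * (S n1 * d)))).
  rewrite -swA; last by lin.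
  rewrite -(@sw_counitl _ _ _ h (fun v => \sw_(c, d <- comul v)
    \sw_(n0, n1 <- rho (act (c ⊗ m))) G n0 (S n1 * d))); last by lin.
  apply: eq_sw => u v; rewrite swC swZ; apply: eq_sw => c d.
  rewrite swC swZ; apply: eq_sw => n0 n1.
  rewrite -[S n1]mul1r -mulrA -(@sw_antipoder _ _ _ _ (fun x => G n0 (x * (S n1 * d))));
    last by lin.
  by apply: eq_sw => a b; rewrite mul1r !mulrA.
apply: eq_sw => a u; rewrite -swA; last by lin.
transitivity (\sw_(x, d <- comul u) \sw_(b, c <- comul x) \sw_(m0, m1 <- rho m)
   G (act (b ⊗ m0)) (a * (S m1 * (S c * d)))).
  apply: eq_sw => x d.
  transitivity (\sw_(b, c <- comul x) \sw_(n0, n1 <- rho (act (c ⊗ m)))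
     G n0 (a * (S (n1 * b) * d))).
    by do 2 (apply: eq_sw => ? ?); rewrite SM !mulrA.
  rewrite -(@sw_YD _ x m (fun n y => G n (a * (S y * d)))); last by lin.
  by do 2 (apply: eq_sw => ? ?); rewrite SM !mulrA.
rewrite swA; last by lin.
rewrite -[RHS](@sw_counitr _ _ _ u (fun b => \sw_(m0, m1 <- rho m)
   G (act (b ⊗ m0)) (a * S m1))); last by lin.
apply: eq_sw => b y; rewrite swC swZ; apply: eq_sw => m0 m1.
by rewrite (@sw_antipodel _ _ _ _ (fun x => G (act (b ⊗ m0)) (a * (S m1 * x)))) ?mulr1; lin.
Qed.

(** As for the left version, but the division is by L over the coopposite Hopf
    algebra, so the first leg goes to L and [twisted_YD] is the relevant form of
    the compatibility of M. *)
Lemma inv_rho_right h m : twisted_rho S (Lbar h m) = inv_rho S Lbar h m.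
Proof.
have tl := twisted_rho_lin S; have ib := inv_rho_bilin S Lbar_bilin.
have key (x : H) n : \sw_(a, b <- comul x) inv_rho S Lbar b (act (a ⊗ n))
    = counit x *: twisted_rho S n.
  transitivity (\sw_(a, x' <- comul x) \sw_(b, y <- comul x') \sw_(c, d <- comul y)
     \sw_(n0, n1 <- rho (act (a ⊗ n))) (Lbar c n0 ⊗ (si d * (S n1 * b)))) => //.
  rewrite -swA; last by lin.
  transitivity (\sw_(u, y <- comul x) \sw_(a, b <- comul u) \sw_(c, d <- comul y)
     \sw_(m0, m1 <- rho n) (Lbar c (act (b ⊗ m0)) ⊗ (si d * (a * S m1)))).
    apply: eq_sw => u y; rewrite swC [RHS]swC; apply: eq_sw => c d.
    by rewrite (@twisted_YD _ u n (fun n x => Lbar c n ⊗ (si d * x))) //; lin.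
  rewrite swA; last by lin.
  transitivity (\sw_(a, d <- comul x) \sw_(m0, m1 <- rho n) (m0 ⊗ (si d * a * S m1))).
    apply: eq_sw => a v; rewrite -swA; last by lin.
    rewrite -[RHS](@sw_counitl _ _ _ v (fun d => \sw_(m0, m1 <- rho n)
      (m0 ⊗ (si d * a * S m1)))); last by lin.
    apply: eq_sw => u d; rewrite swC swZ; apply: eq_sw => m0 m1.
    rewrite -(sw_lin _ _ (pure_linearl (si d * (a * S m1)))) Lbar_left.
    by rewrite (lin_homog (pure_linearl _)) mulrA.
  rewrite swC /twisted_rho swZ; apply: eq_sw => m0 m1.
  by rewrite (@sw_antipode_invl _ _ (fun x => m0 ⊗ (x * S m1))) ?mul1r //; lin.
rewrite (@conv_divr k (coopposite SK SinvK) M _ (inv_rho S Lbar)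
   (fun h m => counit h *: twisted_rho S m) (fun h m => act (h ⊗ m)) Lbar)
   => [|||||x n|x n]; try by lin.
- have lemb : linear (fun x => twisted_rho S (Lbar x m)) by lin.
  by rewrite (@sw_counitl k (coopposite SK SinvK) _ _ _ lemb).
- by rewrite sw_coopposite //; lin.
by rewrite sw_coopposite ?key //; lin.
Qed.

Variable actE : {linear (H ⊗ 'End(M))%type -> 'End(M)}.
Hypothesis actE_E : forall h f m, actE (h ⊗ f) m
  = \sw_(a, b <- comul h) act (b ⊗ f (Lbar a m)).
Variable rhoE : {linear 'End(M) -> ('End(M) ⊗ H)%type}.
Hypothesis sw_rhoE : forall U f m (G : M -> H -> U), bilin G ->
  \sw_(f0, f1 <- rhoE f) G (f0 m) f1
  = \sw_(m0, m1 <- rho m) \sw_(n0, n1 <- rho (f m0)) G n0 (n1 * S m1).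

(** Here both rewritings take place on the side of h_1.f_0 (x) h_2 f_1: the
    compatibility of M for the legs h_2, h_3, which leaves h_2 next to the
    coaction of Lbar(h_1)m, and then [sw_inverse_coaction]. *)
Lemma end_YD_right : YD_compatible actE rhoE.
Proof.
move=> h f; apply: tensor_end_inj => m; rewrite !sw_sw; try by lin.
transitivity (\sw_(u, b <- comul h) \sw_(c, d <- comul u) \sw_(m0, m1 <- rho m)
    \sw_(n0, n1 <- rho (act (b ⊗ f (Lbar d m0)))) (n0 ⊗ (n1 * (S m1 * c)))).
  transitivity (\sw_(a, b <- comul h) \sw_(c, d <- comul a)
      \sw_(m0, m1 <- rho (Lbar c m)) \sw_(n0, n1 <- rho (f m0))
        (act (d ⊗ n0) ⊗ (b * (n1 * S m1)))).
    apply: eq_sw => a b; rewrite sw_sw; last by lin.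
    transitivity (\sw_(f0, f1 <- rhoE f) \sw_(c, d <- comul a)
        (act (d ⊗ f0 (Lbar c m)) ⊗ (b * f1))).
      apply: eq_sw => f0 f1; rewrite sw_pure; last by lin.
      by rewrite actE_E (sw_lin _ _ (pure_linearl _)).
    rewrite swC; apply: eq_sw => c d.
    by rewrite (sw_rhoE f (Lbar c m) (G := fun n x => act (d ⊗ n) ⊗ (b * x))) //; lin.
  rewrite swA; last by lin.
  transitivity (\sw_(c, x <- comul h) \sw_(d, b <- comul x) \sw_(m0, m1 <- rho (Lbar c m))
     \sw_(n0, n1 <- rho (act (b ⊗ f m0))) (n0 ⊗ (n1 * (d * S m1)))).
    apply: eq_sw => c x; rewrite swC [RHS]swC; apply: eq_sw => m0 m1.
    transitivity (\sw_(d, b <- comul x) \sw_(n0, n1 <- rho (f m0))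
      (act (d ⊗ n0) ⊗ (b * n1 * S m1))).
      by do 2 (apply: eq_sw => ? ?); rewrite !mulrA.
    rewrite (@sw_YD _ x _ (fun n y => n ⊗ (y * S m1))); last by lin.
    by do 2 (apply: eq_sw => ? ?); rewrite !mulrA.
  rewrite -swA; last by lin.
  apply: eq_sw => u b.
  by rewrite (sw_inverse_coaction Lbar_bilin inv_rho_right u m (G := fun p y =>
    \sw_(n0, n1 <- rho (act (b ⊗ f p))) (n0 ⊗ (n1 * y)))) //; lin.
rewrite swA; last by lin.
apply: eq_sw => a b; rewrite sw_sw; last by lin.
transitivity (\sw_(f0, f1 <- rhoE (actE (b ⊗ f))) (f0 m ⊗ (f1 * a))); last first.
  by apply: eq_sw => f0 f1; rewrite sw_pure //; lin.
rewrite (sw_rhoE _ m (G := fun n x => n ⊗ (x * a))); last by lin.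
rewrite swC; apply: eq_sw => m0 m1; rewrite actE_E.
rewrite (sw_lin _ _ (linearP rho)) sw_sw; last by lin.
by do 2 (apply: eq_sw => ? ?); rewrite !mulrA.
Qed.

End Right.
End Compatibility.

(** * The two Yetter-Drinfeld algebras *)

Lemma end_comp_bilin (k : fieldType) (M : vectType k) :
  bilin (fun f g : 'End(M) => (f \o g)%VF).
Proof.
split=> [g a f f'|f a g g']; apply/lfunP=> m;
  by rewrite !(add_lfunE, scale_lfunE, comp_lfunE) ?linearP.
Qed.

Lemma end_algebra (k : fieldType) (M : vectType k) :
  is_algebra (fun f g : 'End(M) => (f \o g)%VF) \1%VF.
Proof.
split; first exact: end_comp_bilin.
- by move=> f g h; rewrite comp_lfunA.
- by move=> f; rewrite comp_lfun1l.
- by move=> f; rewrite comp_lfun1r.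
Qed.

Lemma end_op_algebra (k : fieldType) (M : vectType k) :
  is_algebra (fun f g : 'End(M) => (g \o f)%VF) \1%VF.
Proof.
have [cl cr] := end_comp_bilin M.
split; first by split.
- by move=> f g h; rewrite comp_lfunA.
- by move=> f; rewrite comp_lfun1r.
- by move=> f; rewrite comp_lfun1l.
Qed.

Section Endomorphisms.
Variables (k : fieldType) (H : hopfAlgebra k).
Variables (Sinv : H -> H) (SK : cancel antipode Sinv) (SinvK : cancel Sinv antipode).
Variables (sigma tau : {scalar (H ⊗ H)%type}).
Hypotheses (sigma_lazy : lazy sigma) (sigma_inv : convolution_inverse sigma tau).
Variables (M : vectType k) (act : {linear (H ⊗ M)%type -> M}).
Variable rho : {linear M -> (M ⊗ H)%type}.
Hypotheses (actM : is_left_module (cocycle_mul sigma) act)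
  (rhoM : is_right_comodule rho) (YD : YD_compatible act rho).
Local Notation si := (antipode_inv SK SinvK).

Lemma end_YD_algebra :
  exists (actE : {linear (H ⊗ 'End(M))%type -> 'End(M)})
         (rhoE : {linear 'End(M) -> ('End(M) ⊗ H)%type}),
    [/\ forall h (f : 'End(M)) m, actE (h ⊗ f) m
          = \sw_(h1, h2 <- comul h) act (h1 ⊗ f (act (S1 tau h2 ⊗ m))),
        forall (f : 'End(M)) m,
          \sw_(f0, f1 <- rhoE f) (f0 m ⊗ f1)
          = \sw_(m0, m1 <- rho m) \sw_(n0, n1 <- rho (f m0)) (n0 ⊗ (Sinv m1 * n1))
      & is_YD_algebra (fun f g => (f \o g)%VF) \1%VF actE rhoE].
Proof.
pose Lbar h m := act (S1 tau h ⊗ m).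
have Lbarb : bilin Lbar := S1_bilin tau act.
have Lbar_left : forall h m,
  \sw_(a, b <- comul h) Lbar a (act (b ⊗ m)) = counit h *: m := act_S1_left sigma_inv actM.
have Lbar_right : forall h m,
  \sw_(a, b <- comul h) act (a ⊗ Lbar b m) = counit h *: m :=
  act_S1_right sigma_lazy sigma_inv actM.
pose mu (x y : H) := si x * y.
have mub : bilin mu by rewrite /mu; lin.
have mulb : bilin (fun x y : H => x * y) by lin.
exists (adj_act act Lbarb), (end_rho rho mub).
have actE_E h (f : 'End(M)) m : adj_act act Lbarb (h ⊗ f) m
    = \sw_(h1, h2 <- comul h) act (h1 ⊗ f (Lbar h2 m)) by rewrite adj_actE adjE.
split=> // [f m|].
  by rewrite (sw_end_rho rho mub f m (G := fun n x => n ⊗ x)) //; lin.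
split.
- split.
  + refine (adj_module sigma_lazy actM Lbarb Lbar_left Lbar_right).
  + apply: (end_rho_comodule rhoM mub).
      exact: counit_antipode_inv_mul.
    exact: comul_antipode_inv_mul.
  + apply: (end_YD_left (SK := SK) (SinvK := SinvK) YD Lbarb Lbar_left Lbar_right actE_E).
    by move=> *; apply: sw_end_rho.
- exact: end_algebra.
- split=> [h f g|h]; rewrite !adj_actE; last exact: adj_id.
  by rewrite (adj_comp Lbarb Lbar_left); apply: eq_sw => a b; rewrite !adj_actE.
- split=> [f g|].
    apply: (end_rho_comp rhoM mub mulb) => x y z.
    have := @sw_antipode_invr k H Sinv SK SinvK H y (fun w => si x * (w * z)).
    rewrite mul1r => <-; last by lin.
    by apply: eq_sw => a b; rewrite /mu !mulrA.
  apply: (end_rho_id rhoM mub) => x.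
  exact: (@sw_antipode_invl k H Sinv SK SinvK H x id).
Qed.

Lemma end_op_YD_algebra :
  exists (actE : {linear (H ⊗ 'End(M))%type -> 'End(M)})
         (rhoE : {linear 'End(M) -> ('End(M) ⊗ H)%type}),
    [/\ forall h (f : 'End(M)) m, actE (h ⊗ f) m
          = \sw_(h1, h2 <- comul h) act (h2 ⊗ f (act (S2 tau Sinv h1 ⊗ m))),
        forall (f : 'End(M)) m,
          \sw_(f0, f1 <- rhoE f) (f0 m ⊗ f1)
          = \sw_(m0, m1 <- rho m) \sw_(n0, n1 <- rho (f m0)) (n0 ⊗ (n1 * antipode m1))
      & is_YD_algebra (fun f g => (g \o f)%VF) \1%VF actE rhoE].
Proof.
pose Hcop := coopposite SK SinvK.
pose Lbar h m := act (S2 tau Sinv h ⊗ m).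
have Lbarb : bilin Lbar := S2_bilin SK SinvK tau act.
have Lbar_left : forall (h : Hcop) m,
  \sw_(a, b <- comul h) Lbar a (act (b ⊗ m)) = counit h *: m :=
  act_S2_left_cop sigma_lazy sigma_inv actM.
have Lbar_right : forall (h : Hcop) m,
  \sw_(a, b <- comul h) act (a ⊗ Lbar b m) = counit h *: m :=
  act_S2_right_cop sigma_lazy sigma_inv actM.
have lazy_cop : @lazy k Hcop sigma := lazy_coopposite sigma_lazy.
have module_cop : is_left_module (@cocycle_mul k Hcop sigma) act :=
  module_coopposite SK SinvK sigma_lazy actM.
pose mu (x y : H) := y * antipode x.
have mub : bilin mu by rewrite /mu; lin.
have mulb : bilin (fun x y : H => y * x) by lin.
have Sl := Sinv_lin SK SinvK.
pose actE := @adj_act k Hcop M act Lbar Lbarb.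
exists actE, (end_rho rho mub).
have actE_E (h : H) (f : 'End(M)) m : actE (h ⊗ f) m
    = \sw_(h1, h2 <- comul h) act (h2 ⊗ f (Lbar h1 m)).
  by rewrite [actE _]adj_actE adjE sw_coopposite //; lin.
split=> // [f m|].
  by rewrite (sw_end_rho rho mub f m (G := fun n x => n ⊗ x)) //; lin.
split.
- split.
  + refine (@adj_module k Hcop sigma lazy_cop M act module_cop Lbar Lbarb Lbar_left Lbar_right).
  + apply: (end_rho_comodule rhoM mub).
      exact: counit_mul_antipode.
    exact: comul_mul_antipode.
  + apply: (@end_YD_right k H Sinv SK SinvK M act rho YD Lbar Lbarb _ _ actE actE_E).
    * exact: (act_S2_left SK SinvK sigma_lazy sigma_inv actM).
    * exact: (act_S2_right SK SinvK sigma_lazy sigma_inv actM).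
    * by move=> *; apply: sw_end_rho.
- exact: end_op_algebra.
- split=> [h f g|h]; last first.
    by rewrite [LHS]adj_actE; exact: (@adj_id k Hcop).
  rewrite [LHS]adj_actE [LHS](@adj_comp k Hcop M act Lbar Lbarb Lbar_left) sw_coopposite.
    by apply: eq_sw => a b; rewrite [actE (a ⊗ f)]adj_actE [actE (b ⊗ g)]adj_actE.
  have adjb := @adj_bilin k Hcop M act Lbar Lbarb; have cb := end_comp_bilin M.
  split=> v; first exact: lin_bill cb (lin_bill adjb (@lin_id _ _)).
  exact: lin_bilr cb (lin_bill adjb (@lin_id _ _)).
- split=> [f g|].
    rewrite (end_rho_comp rhoM mub mulb) => [|x y z].
      by rewrite swC.
    have := @sw_antipodel k H H y (fun w => z * (w * antipode x)).
    rewrite mul1r => <-; last by lin.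
    by apply: eq_sw => a b; rewrite /mu !mulrA.
  apply: (end_rho_id rhoM mub) => x.
  exact: (@sw_antipoder k H H x id).
Qed.

End Endomorphisms.

Unset Implicit Arguments.

Theorem proposition5p4 (k : fieldType) (H : hopfAlgebra k)
    (Sinv : H -> H) (SK : cancel antipode Sinv) (SinvK : cancel Sinv antipode)
    (sigma tau : {scalar (H ⊗ H)%type})
    (sigma_cocycle : left_2cocycle sigma) (sigma_lazy : lazy sigma)
    (sigma_normalized : normalized sigma)
    (sigma_inv : convolution_inverse sigma tau)
    (M : vectType k)
    (act : {linear (H ⊗ M)%type -> M}) (rho : {linear M -> (M ⊗ H)%type})
    (M_YD : is_twisted_YD sigma act rho) :
  (exists (actE : {linear (H ⊗ 'End(M))%type -> 'End(M)})
          (rhoE : {linear 'End(M) -> ('End(M) ⊗ H)%type}),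
    [/\ forall h (f : 'End(M)) m, actE (h ⊗ f) m
          = \sw_(h1, h2 <- comul h) act (h1 ⊗ f (act (S1 tau h2 ⊗ m))),
        forall (f : 'End(M)) m,
          \sw_(f0, f1 <- rhoE f) (f0 m ⊗ f1)
          = \sw_(m0, m1 <- rho m) \sw_(n0, n1 <- rho (f m0)) (n0 ⊗ (Sinv m1 * n1))
      & is_YD_algebra (fun f g => (f \o g)%VF) \1%VF actE rhoE])
  /\
  (exists (actE : {linear (H ⊗ 'End(M))%type -> 'End(M)})
          (rhoE : {linear 'End(M) -> ('End(M) ⊗ H)%type}),
    [/\ forall h (f : 'End(M)) m, actE (h ⊗ f) m
          = \sw_(h1, h2 <- comul h) act (h2 ⊗ f (act (S2 tau Sinv h1 ⊗ m))),
        forall (f : 'End(M)) m,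
          \sw_(f0, f1 <- rhoE f) (f0 m ⊗ f1)
          = \sw_(m0, m1 <- rho m) \sw_(n0, n1 <- rho (f m0)) (n0 ⊗ (n1 * antipode m1))
      & is_YD_algebra (fun f g => (g \o f)%VF) \1%VF actE rhoE]).
Proof.
have [actM rhoM YD] := M_YD; split.
  exact: (end_YD_algebra SK SinvK sigma_lazy sigma_inv actM rhoM YD).
exact: (end_op_YD_algebra SK SinvK sigma_lazy sigma_inv actM rhoM YD).
Qed.
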